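(* For $n\geq 1$, let $P_n,Q_n\in\mathbb{R}[z]\subset\Gamma(\mathbb{S}^2_{\mathbb{C}},\mathcal{O}_{\mathbb{S}^2_{\mathbb{C}}})$ be any polynomials such that $$(1+z)^nP_n(z)+(1-z)^nQ_n(z)=1.$$ Let $q_n:V_n\to\mathbb{S}^2$ be the rank $2$ algebraic vector bundle defined in the context. Then the following hold: a) The composition $\Sigma_n=j_n\circ\Sigma_0$ of the canonical product real structure $\Sigma_0=\sigma_{\mathbb{S}^2}\times\sigma_{\mathbb{A}^2_{\mathbb{R}}}$ on $\mathbb{S}^2_{\mathbb{C}}\times\mathbb{A}^2_{\mathbb{C}}$ with the automorphism $j_n$ of the trivial bundle $\mathbb{S}^2_{\mathbb{C}}\times\mathbb{A}^2_{\mathbb{C}}$ defined by the matrix $$A_n=\begin{pmatrix}(x-iy)^n(P_n+Q_n) & (1-z)^n-(1+z)^n\\ -(1+z)^nP_n^2+(1-z)^nQ_n^2 & -(x+iy)^n(P_n+Q_n)\end{pmatrix}\in\mathrm{GL}_2(\Gamma(\mathbb{S}^2_{\mathbb{C}},\mathcal{O}_{\mathbb{S}^2_{\mathbb{C}}}))$$ is a real structure on $\mathbb{S}^2_{\mathbb{C}}\times\mathbb{A}^2_{\mathbb{C}}$. b) There exists an isomorphism $\Theta_n:V_{n,\mathbb{C}}\to\mathbb{S}^2_{\mathbb{C}}\times\mathbb{A}^2_{\mathbb{C}}$ of vector bundles over $\mathbb{S}^2_{\mathbb{C}}$ such that $\Sigma_n\circ\Theta_n=\Theta_n\circ\sigma_{V_n}$,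 where $\sigma_{V_n}$ denotes the canonical real structure on $V_{n,\mathbb{C}}$.
   Context: Real/complex algebraic varieties are geometrically integral quasi-projective schemes of finite type over $\mathbb{R}$, resp. $\mathbb{C}$. For a real algebraic variety $X$, $X_{\mathbb{C}}=X\times_{\mathrm{Spec}\,\mathbb{R}}\mathrm{Spec}\,\mathbb{C}$ is its complexification, with canonical real structure $\sigma_X=\mathrm{id}_X\times\tau$, where $\tau$ is complex conjugation on $\mathrm{Spec}\,\mathbb{C}$. A real structure on a complex variety is an anti-regular involution (an $\mathbb{R}$-scheme involution lifting $\tau$). A matrix $A$ with entries regular functions on $\mathbb{S}^2_{\mathbb{C}}$ acts on the trivial bundle by $(s,v)\mapsto(s,A(s)v)$, with $v$ a column vector. Descent construction: let $p:E\to X_{\mathbb{C}}$ be an algebraic vector bundle of rank $r$. The isomorphism $E\oplus\sigma_X^*E\to\sigma_X^*(E\oplus\sigma_X^*E)=\sigma_X^*E\oplus E$ exchanging the two summands defines a lift of $\sigma_X$ to a real structure $\tilde\sigma$ on the total space of $E\oplus\sigma_X^*E$ (on points over $s$, it sends $(e,e')\in E_s\oplus E_{\sigma_X(s)}$ to $(e',e)$ over $\sigma_X(s)$). The quotient $E_{\mathbb{R}}:=(E\oplus\sigma_X^*E)/\langle\tilde\sigma\rangle\to X=X_{\mathbb{C}}/\langle\sigma_X\rangle$ is an algebraic vector bundle of rank $2r$ on $X$. The bundles $V_n$: let $\mathbb{Q}^2=\{X^2+Y^2+Z^2-T^2=0\}\subset\mathbb{P}^3_{\mathbb{R}}$ and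 $\mathbb{S}^2=\mathbb{Q}^2\setminus\{T=0\}=\mathrm{Spec}(\mathbb{R}[x,y,z]/(x^2+y^2+z^2-1))$. The map $([x_0:x_1],[y_0:y_1])\mapsto[x_0y_1+x_1y_0:\,i(x_1y_0-x_0y_1):\,x_0y_0-x_1y_1:\,x_0y_0+x_1y_1]$ is an isomorphism $\psi:\mathbb{P}^1_{\mathbb{C}}\times\mathbb{P}^1_{\mathbb{C}}\to\mathbb{Q}^2_{\mathbb{C}}$, under which $\sigma_{\mathbb{Q}^2}$ corresponds to $\sigma=s_\Delta\circ(\sigma_{\mathbb{P}^1_{\mathbb{R}}}\times\sigma_{\mathbb{P}^1_{\mathbb{R}}})$, with $s_\Delta$ the exchange of the two factors. For $n\ge0$, let $L_n=\mathrm{pr}_1^*\mathcal{O}_{\mathbb{P}^1_{\mathbb{C}}}(n)$ on $\mathbb{P}^1_{\mathbb{C}}\times\mathbb{P}^1_{\mathbb{C}}\simeq\mathbb{Q}^2_{\mathbb{C}}$, let $p_{n,\mathbb{R}}:L_{n,\mathbb{R}}\to\mathbb{Q}^2$ be the rank $2$ vector bundle obtained from $L_n$ by the descent construction, and let $q_n:V_n\to\mathbb{S}^2$ be its restriction to $\mathbb{S}^2$. *)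

(* Defs.v *)
(* Varieties are treated classically: a complex variety is given by its complex
   points and its regular functions.  A real variety is given by its R-algebra
   of regular functions; this is enough here, because the real varieties
   considered (S^2 and vector bundles over it) are affine. *)
From HB Require Import structures.
From mathcomp Require Import all_boot all_order all_algebra generic_quotient.
From mathcomp Require Import boolp functions reals.
From mathcomp Require Import mpoly complex ring.

Set Implicit Arguments.
Unset Strict Implicit.
Unset Printing Implicit Defensive.

Import GRing.Theory Num.Theory.
Local Open Scope ring_scope.
Local Open Scope quotient_scope.

Section Functions.
Variable R : realType.
Local Notation C := R[i].

(* On D, f is a polynomial in the coordinates c. *)
Definition poly_on (T : Type) (N : nat) (D : pred T) (c : T -> 'rV[C]_N)
    (f : T -> C) : Prop :=
  exists p : {mpoly C[N]}, forall x, D x -> f x = p.@[c x 0].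

(* On D, f is a linear form in the fibre coordinates l, with coefficients
   polynomial in the base coordinates c. *)
Definition linpoly_on (T : Type) (N r : nat) (D : pred T) (c : T -> 'rV[C]_N)
    (l : T -> 'rV[C]_r) (f : T -> C) : Prop :=
  exists p : 'I_r -> {mpoly C[N]},
    forall x, D x -> f x = \sum_(k < r) (p k).@[c x 0] * l x 0 k.

Lemma poly_on_sub T N D (c : T -> 'rV[C]_N) f g :
  poly_on D c f -> poly_on D c g -> poly_on D c (f - g).
Proof.
move=> [p Hp] [q Hq]; exists (p - q) => x Dx.
by rewrite mevalB -Hp // -Hq.
Qed.

Lemma poly_on_mul T N D (c : T -> 'rV[C]_N) f g :
  poly_on D c f -> poly_on D c g -> poly_on D c (f * g).
Proof.
move=> [p Hp] [q Hq]; exists (p * q) => x Dx.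
by rewrite mevalM -Hp // -Hq.
Qed.

Lemma poly_on_cst T N D (c : T -> 'rV[C]_N) (a : C) : poly_on D c (fun=> a).
Proof. by exists a%:MP => x _; rewrite mevalC. Qed.

Lemma poly_on_coord T N D (c : T -> 'rV[C]_N) k : poly_on D c (fun x => c x 0 k).
Proof. by exists 'X_k => x _; rewrite mevalXU. Qed.

Definition conj_mx m n (A : 'M[C]_(m, n)) : 'M[C]_(m, n) := map_mx Num.conj A.

Lemma conj_mxK m n : involutive (@conj_mx m n).
Proof. by move=> A; apply/matrixP => i j; rewrite !mxE conjCK. Qed.

Lemma conj_mx0 m n : conj_mx (0 : 'M_(m, n)) = 0.
Proof. exact: map_mx0. Qed.

Lemma conj_mx_eq0 m n (A : 'M_(m, n)) : (conj_mx A == 0) = (A == 0).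
Proof. by rewrite -{1}(conj_mx0 m n) (inj_eq (inv_inj (@conj_mxK m n))). Qed.

End Functions.

Section Projective.
Variables (R : realType) (N : nat).
Local Notation C := R[i].

Definition cone := {u : 'rV[C]_N.+1 | u != 0}.

Definition proj_rel (u v : cone) : bool :=
  `[< exists l : C, l != 0 /\ val v = l *: val u >].

Lemma proj_rel_refl : reflexive proj_rel.
Proof. by move=> u; apply/asboolP; exists 1; rewrite oner_neq0 scale1r. Qed.

Lemma proj_rel_sym : ssrbool.symmetric proj_rel.
Proof.
suff h u v : proj_rel u v -> proj_rel v u by move=> u v; apply/idP/idP; apply: h.
move=> /asboolP[l [l0 e]]; apply/asboolP; exists l^-1.
by rewrite invr_eq0 e scalerA mulVf // scale1r.
Qed.

Lemma proj_rel_trans : transitive proj_rel.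
Proof.
move=> v u w /asboolP[l [l0 e]] /asboolP[m [m0 f]]; apply/asboolP.
by exists (m * l); rewrite mulf_neq0 // f e scalerA.
Qed.

Canonical proj_equiv :=
  EquivRel proj_rel proj_rel_refl proj_rel_sym proj_rel_trans.

Definition PN := {eq_quot proj_equiv}.
HB.instance Definition _ := Choice.on PN.
HB.instance Definition _ := EqQuotient.on PN.

Definition hcoord (p : PN) : 'rV[C]_N.+1 := val (repr p).

Lemma hcoord_neq0 p : hcoord p != 0.
Proof. exact: valP (repr p). Qed.

Definition topt (u : 'rV[C]_N.+1) (u0 : u != 0) : PN :=
  \pi_PN (Sub u u0 : cone).

Lemma eq_topt u v u0 v0 (l : C) :
  l != 0 -> v = l *: u -> @topt u u0 = @topt v v0.
Proof.
by move=> l0 e; apply/eqmodP/asboolP; exists l; rewrite !SubK.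
Qed.

Lemma hcoord_topt u u0 :
  exists l : C, l != 0 /\ hcoord (@topt u u0) = l *: u.
Proof.
have /eqmodP/asboolP[l [l0 e]] : Sub u u0 = repr (@topt u u0) %[mod PN].
  by rewrite reprK.
by exists l; split => //; rewrite /hcoord e SubK.
Qed.

Lemma toptK p : topt (hcoord_neq0 p) = p.
Proof. by rewrite /topt -[RHS]reprK; congr (\pi _); apply: val_inj; rewrite SubK. Qed.

Lemma conj_hcoord_neq0 p : conj_mx (hcoord p) != 0.
Proof. by rewrite conj_mx_eq0 hcoord_neq0. Qed.

Definition conj_proj (p : PN) : PN := topt (conj_hcoord_neq0 p).

Lemma conj_topt u (u0 : u != 0) (v0 : conj_mx u != 0) :
  conj_proj (topt u0) = topt v0.
Proof.
have [l [l0 e]] := hcoord_topt u0.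
symmetry; apply: (@eq_topt _ _ _ _ (Num.conj l)); first by rewrite conjC_eq0.
by rewrite e /conj_mx map_mxZ.
Qed.

Lemma conj_projK : involutive conj_proj.
Proof.
move=> p; rewrite -{2}(toptK p) {2}/conj_proj.
have w0 : conj_mx (conj_mx (hcoord p)) != 0 by rewrite conj_mxK hcoord_neq0.
rewrite (conj_topt _ w0); apply: (@eq_topt _ _ _ _ 1); first exact: oner_neq0.
by rewrite conj_mxK scale1r.
Qed.

End Projective.

(* The total space of O(n) on P^1.  A point of the fibre over [u] is a
   homogeneous function of degree n on the line C u, recorded by its value t
   at u; so (u, t) and (l u, l^n t) are identified, and the homogeneous
   polynomials of degree n are sections. *)
Section On.
Variables (R : realType) (n : nat).
Local Notation C := R[i].

Definition On_rel (a b : cone R 1 * C) : bool :=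
  `[< exists l : C, [/\ l != 0, val b.1 = l *: val a.1 & b.2 = l ^+ n * a.2] >].

Lemma On_rel_refl : reflexive On_rel.
Proof.
move=> a; apply/asboolP; exists 1.
by rewrite oner_neq0 scale1r expr1n mul1r.
Qed.

Lemma On_rel_sym : ssrbool.symmetric On_rel.
Proof.
suff h a b : On_rel a b -> On_rel b a by move=> a b; apply/idP/idP; apply: h.
move=> /asboolP[l [l0 e f]]; apply/asboolP; exists l^-1.
by rewrite invr_eq0 e f scalerA mulVf // scale1r mulrA -exprMn mulVf // expr1n mul1r.
Qed.

Lemma On_rel_trans : transitive On_rel.
Proof.
move=> b a c /asboolP[l [l0 e f]] /asboolP[m [m0 g h]]; apply/asboolP.
by exists (m * l); rewrite mulf_neq0 // g e h f scalerA exprMn mulrA.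
Qed.

Canonical On_equiv := EquivRel On_rel On_rel_refl On_rel_sym On_rel_trans.

Definition On := {eq_quot On_equiv}.
HB.instance Definition _ := Choice.on On.
HB.instance Definition _ := EqQuotient.on On.

Definition On_base (e : On) : PN R 1 := \pi_(PN R 1) (repr e).1.

(* The fibre coordinate t / u_i^n, meaningful over {u_i <> 0}. *)
Definition On_coord (i : 'I_2) (e : On) : C :=
  (repr e).2 / (val (repr e).1 0 i) ^+ n.

End On.

(* A vector bundle of rank r over X, presented by a trivialising atlas: over
   the affine open set adom i, abase i are affine coordinates on the base
   (generating its coordinate ring), and afib i are linear coordinates on the
   fibres. *)
Record atlas_bundle (R : realType) (X : eqType) := AtlasBundle {
  atot : eqType;
  aproj : atot -> X;
  aidx : Type;
  adom : aidx -> pred X;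
  adim : nat;
  abase : aidx -> X -> 'rV[R[i]]_adim;
  arank : nat;
  afib : aidx -> atot -> 'rV[R[i]]_arank
}.

(* E + sigma^* E and the lift of sigma, for an anti-regular involution sigma of
   the (separated) variety X.  The fibre of sigma^* E at x is the fibre of E at
   sigma x with the conjugate complex structure, whence the conjugates in the
   coordinates. *)
Section Descent.
Variables (R : realType) (X : eqType) (E : atlas_bundle R X) (sigma : X -> X).

Definition dtot := {w : atot E * atot E | aproj w.2 == sigma (aproj w.1)}.

Definition descent_bundle : atlas_bundle R X :=
  @AtlasBundle R X dtot (fun w => aproj (val w).1)
    (aidx E * aidx E)
    (fun ij x => adom ij.1 x && adom ij.2 (sigma x))
    (adim E + adim E)
    (fun ij x => row_mx (abase ij.1 x) (conj_mx (abase ij.2 (sigma x))))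
    (arank E + arank E)
    (fun ij w => row_mx (afib ij.1 (val w).1) (conj_mx (afib ij.2 (val w).2))).

Hypothesis sigmaK : involutive sigma.

Lemma dswap_subproof (w : dtot) :
  aproj (val w).1 == sigma (aproj (val w).2).
Proof. by rewrite (eqP (valP w)) sigmaK. Qed.

Definition dswap (w : dtot) : dtot :=
  exist _ ((val w).2, (val w).1) (dswap_subproof w).

Lemma dswapK : involutive dswap.
Proof. by move=> w; apply: val_inj => /=; case: (val w). Qed.

End Descent.

Section Quadric.
Variable R : realType.
Local Notation C := R[i].
Local Notation P1 := (PN R 1).
Local Notation P3 := (PN R 3).

Definition sigmaP1P1 (p : P1 * P1) : P1 * P1 := (conj_proj p.2, conj_proj p.1).

Lemma sigmaP1P1K : involutive sigmaP1P1.
Proof. by case=> p q; rewrite /sigmaP1P1 /= !conj_projK. Qed.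

(* psi([u], [v]) = [X : Y : Z : T]. *)
Definition psi_vec (u v : 'rV[C]_2) : 'rV[C]_4 :=
  \row_k [:: u 0 0 * v 0 1 + u 0 1 * v 0 0;
             'i * (u 0 1 * v 0 0 - u 0 0 * v 0 1);
             u 0 0 * v 0 0 - u 0 1 * v 0 1;
             u 0 0 * v 0 0 + u 0 1 * v 0 1]`_k.

Lemma psi_vec_neq0 u v : u != 0 -> v != 0 -> psi_vec u v != 0.
Proof.
move=> /rV0Pn[i ui] /rV0Pn[j vj]; apply/negP => /eqP/rowP e.
have two0 : (2 : C) != 0 by rewrite pnatr_eq0.
have half (a b : C) : a + b = 0 -> a - b = 0 -> a = 0 /\ b = 0.
  move=> /eqP; rewrite addr_eq0 => /eqP -> /eqP.
  rewrite -opprD oppr_eq0 -mulr2n -mulr_natl mulf_eq0 (negPf two0) /= => /eqP ->.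
  by rewrite oppr0.
have [/= e0 e1 e2 e3] : [/\ psi_vec u v 0 0 = 0, psi_vec u v 0 1 = 0,
    psi_vec u v 0 2 = 0 & psi_vec u v 0 3 = 0] by rewrite !e !mxE.
move: e0 e1 e2 e3; rewrite !mxE /= => e0 /eqP e1 e2 e3.
rewrite mulf_eq0 (negPf (neq0Ci _)) /= in e1; move/eqP: e1 => e1.
rewrite addrC in e0.
have [a b] := half _ _ e0 e1.
have [c d] := half _ _ e3 e2.
have : u 0 i * v 0 j = 0.
  have io : i = 0 \/ i = 1 by case: i {ui} => [[|[|//]] ?]; [left|right]; apply: val_inj.
  have jo : j = 0 \/ j = 1 by case: j {vj} => [[|[|//]] ?]; [left|right]; apply: val_inj.
  by case: io => ->; case: jo => ->.
by apply/eqP; rewrite mulf_neq0.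
Qed.

Lemma psi_vecZ a b u v : psi_vec (a *: u) (b *: v) = (a * b) *: psi_vec u v.
Proof.
have key (K : comNzRingType) (a' b' c x y z t : K) :
  [/\ a' * x * (b' * y) + a' * z * (b' * t) = a' * b' * (x * y + z * t),
      c * (a' * x * (b' * y) - a' * z * (b' * t)) = a' * b' * (c * (x * y - z * t))
    & a' * x * (b' * y) - a' * z * (b' * t) = a' * b' * (x * y - z * t)].
  by split; ring.
apply/rowP => k; rewrite !mxE; case: k => [[|[|[|[|//]]]] ?] /=.
- by case: (key _ a b 0 (u 0 0) (v 0 1) (u 0 1) (v 0 0)).
- by case: (key _ a b 'i (u 0 1) (v 0 0) (u 0 0) (v 0 1)).
- by case: (key _ a b 0 (u 0 0) (v 0 0) (u 0 1) (v 0 1)).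
- by case: (key _ a b 0 (u 0 0) (v 0 0) (u 0 1) (v 0 1)).
Qed.

Lemma psi_vec_conj u v : psi_vec (conj_mx v) (conj_mx u) = conj_mx (psi_vec u v).
Proof.
have key (K : numClosedFieldType) (x y z t : K) :
  [/\ x^* * y^* + z^* * t^* = (t * z + y * x)^*,
      'i * (x^* * y^* - z^* * t^*) = ('i * (t * z - y * x))^*,
      x^* * y^* - z^* * t^* = (y * x - t * z)^*
    & x^* * y^* + z^* * t^* = (y * x + t * z)^*].
  by rewrite !(rmorphM, rmorphD, rmorphB) /= conjCi; split; ring.
apply/rowP => k; rewrite !mxE; case: k => [[|[|[|[|//]]]] ?] /=.
- by case: (key _ (v 0 0) (u 0 1) (v 0 1) (u 0 0)).
- by case: (key _ (v 0 1) (u 0 0) (v 0 0) (u 0 1)).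
- by case: (key _ (v 0 0) (u 0 0) (v 0 1) (u 0 1)).
- by case: (key _ (v 0 0) (u 0 0) (v 0 1) (u 0 1)).
Qed.

Definition psi (p : P1 * P1) : P3 :=
  topt (psi_vec_neq0 (hcoord_neq0 p.1) (hcoord_neq0 p.2)).

(* The affine sphere x^2 + y^2 + z^2 = 1, its canonical real structure and its
   open immersion s |-> [x : y : z : 1] in the quadric. *)
Definition S2 := {s : 'rV[C]_3 | \sum_(k < 3) s 0 k ^+ 2 == 1}.

Definition S2reg (f : S2 -> C) : Prop := poly_on xpredT (fun s => val s) f.

Lemma sigmaS2_subproof (s : S2) : \sum_(k < 3) (conj_mx (val s)) 0 k ^+ 2 == 1.
Proof.
case: s => s /= /eqP /(congr1 Num.conj); rewrite conjC1 => <-.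
rewrite rmorph_sum /=; apply/eqP/eq_bigr => k _.
by rewrite mxE rmorphXn.
Qed.

Definition sigmaS2 (s : S2) : S2 := exist _ (conj_mx (val s)) (sigmaS2_subproof s).

Lemma sigmaS2K : involutive sigmaS2.
Proof. by move=> s; apply: val_inj; rewrite /= conj_mxK. Qed.

Lemma affine_neq0 (s : 'rV[C]_3) : (row_mx s 1 : 'rV_(3 + 1)) != 0.
Proof.
apply/negP => /eqP; rewrite -[RHS](@row_mx0 _ 1 3 1) => /eq_row_mx[_ /eqP].
by rewrite oner_eq0.
Qed.

Definition S2_in_P3 (s : S2) : P3 := @topt R 3 _ (affine_neq0 (val s)).

Lemma psi_sigma p : psi (sigmaP1P1 p) = conj_proj (psi p).
Proof.
have w0 : conj_mx (psi_vec (hcoord p.1) (hcoord p.2)) != 0.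
  by rewrite conj_mx_eq0 psi_vec_neq0 ?hcoord_neq0.
rewrite /psi (conj_topt _ w0) /=.
have [a [a0 ea]] := hcoord_topt (conj_hcoord_neq0 p.2).
have [b [b0 eb]] := hcoord_topt (conj_hcoord_neq0 p.1).
symmetry; apply: (@eq_topt _ _ _ _ _ _ (a * b)); first by rewrite mulf_neq0.
by rewrite ea eb psi_vecZ psi_vec_conj.
Qed.

Lemma S2_in_P3_sigma s : S2_in_P3 (sigmaS2 s) = conj_proj (S2_in_P3 s).
Proof.
have e : conj_mx (row_mx (val s) 1 : 'rV_(3 + 1)) = row_mx (conj_mx (val s)) 1.
  by rewrite /conj_mx map_row_mx map_mx1.
have w0 : conj_mx (row_mx (val s) 1 : 'rV_(3 + 1)) != 0.
  by rewrite conj_mx_eq0 affine_neq0.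
rewrite /S2_in_P3 (conj_topt _ w0).
symmetry; apply: (@eq_topt _ _ _ _ _ _ 1); first exact: oner_neq0.
by rewrite scale1r e.
Qed.

End Quadric.

(* L_n = pr_1^* O(n) on P^1 x P^1: the pullback of O(n) along pr_1 is
   On x P^1.  Over {u_i <> 0} x {v_j <> 0} the base coordinates are u / u_i and
   v / v_j, and the fibre coordinate is t / u_i^n. *)
Definition Ln (R : realType) (n : nat) : atlas_bundle R (PN R 1 * PN R 1)%type :=
  @AtlasBundle R (PN R 1 * PN R 1)%type (On R n * PN R 1)%type
    (fun e => (On_base e.1, e.2))
    ('I_2 * 'I_2)
    (fun ij p => (hcoord p.1 0 ij.1 != 0) && (hcoord p.2 0 ij.2 != 0))
    (2 + 2)
    (fun ij p => row_mx ((hcoord p.1 0 ij.1)^-1 *: hcoord p.1)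
                        ((hcoord p.2 0 ij.2)^-1 *: hcoord p.2))
    1
    (fun ij e => const_mx (On_coord ij.1 e.1)).

(* Restriction to S^2 of a bundle E over P^1 x P^1, identified by psi with the
   quadric.  The part of the base in S^2 and in the i-th affine chart is closed
   in the product of both, so its coordinate ring is generated by x, y, z and
   the chart coordinates. *)
Section Restriction.
Variables (R : realType) (E : atlas_bundle R (PN R 1 * PN R 1)%type).
Local Notation C := R[i].

Definition rtot := {x : S2 R * atot E | psi (aproj x.2) == S2_in_P3 x.1}.

Definition rbase (x : rtot) : S2 R := (val x).1.

Definition rdom (i : aidx E) : pred rtot := fun x => adom i (aproj (val x).2).

Definition rcoord (i : aidx E) (x : rtot) : 'rV[C]_(3 + adim E) :=
  row_mx (val (rbase x)) (abase i (aproj (val x).2)).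

Definition rfib (i : aidx E) (x : rtot) : 'rV[C]_(arank E) := afib i (val x).2.

Definition rreg (f : rtot -> C) : Prop :=
  forall i, poly_on (rdom i) (fun x => row_mx (rcoord i x) (rfib i x)) f.

Definition rfiblin (f : rtot -> C) : Prop :=
  forall i, linpoly_on (rdom i) (rcoord i) (rfib i) f.

End Restriction.

(* A vector bundle V over the real sphere: the R-algebra of V, the images in it
   of the coordinates x, y, z of S^2 (which give the projection), and the
   functions that are linear on the fibres. *)
Record real_bundle (R : realType) := RealBundle {
  balg : comPzRingType;
  bscal : {rmorphism R -> balg};
  bbase : 'I_3 -> balg;
  bbase_sphere : \sum_(k < 3) bbase k ^+ 2 = 1;
  blin : balg -> Prop
}.

(* The real variety V = (E + sigma^* E) / <sigma~>, restricted to S^2.  Write W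
   for the part of the total space of E + sigma^* E lying over S^2.  The regular
   functions on the quotient are the invariant ones on W, i.e. the regular f
   with f o sigma~ = conj o f; they form the R-algebra qalg. *)
Section Quotient.
Variables (R : realType) (E : atlas_bundle R (PN R 1 * PN R 1)%type).
Local Notation C := R[i].
Local Notation D := (descent_bundle E (@sigmaP1P1 R)).
Local Notation W := (rtot D).

Lemma sigmaW_subproof (x : W) :
  psi (@aproj R _ D (dswap (@sigmaP1P1K R) (val x).2)) == S2_in_P3 (sigmaS2 (val x).1).
Proof.
have /eqP hx := valP x; have /eqP hw := valP (val x).2.
apply/eqP; rewrite S2_in_P3_sigma -[in RHS]hx -psi_sigma.
exact: congr1 hw.
Qed.

Definition sigmaW (x : W) : W :=
  exist _ (sigmaS2 (val x).1, dswap (@sigmaP1P1K R) (val x).2) (sigmaW_subproof x).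

Definition descended : {pred W -> C} := fun f =>
  `[< @rreg R D f /\ forall x, f (sigmaW x) = (f x)^* >].

Lemma descended_subring : subring_closed descended.
Proof.
split.
- apply/asboolP; split => [i|x]; first exact: poly_on_cst.
  by rewrite conjC1.
- move=> f g /asboolP[f1 f2] /asboolP[g1 g2]; apply/asboolP; split => [i|x].
    exact: poly_on_sub.
  by rewrite !fctE f2 g2 rmorphB.
- move=> f g /asboolP[f1 f2] /asboolP[g1 g2]; apply/asboolP; split => [i|x].
    exact: poly_on_mul.
  by rewrite !fctE f2 g2 rmorphM.
Qed.

HB.instance Definition _ :=
  GRing.isSubringClosed.Build (W -> C) descended descended_subring.

Definition qalg := {f : W -> C | f \in descended}.
HB.instance Definition _ := SubType.on qalg.
HB.instance Definition _ := Choice.on qalg.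
HB.instance Definition _ := GRing.SubChoice_isSubComPzRing.Build (W -> C) (mem descended) qalg (descended_subring).


Lemma qscal_subproof (a : R) : (fun=> a%:C%C) \in descended.
Proof.
apply/asboolP; split => [i|x]; first exact: poly_on_cst.
exact: esym (conjc_real a).
Qed.

Definition qscal (a : R) : qalg := exist _ (fun=> a%:C%C) (qscal_subproof a).

Lemma qscal_zmod : zmod_morphism qscal.
Proof.
by move=> a b; apply/val_inj/funext => x; rewrite /= rmorphB.
Qed.

Lemma qscal_monoid : monoid_morphism qscal.
Proof.
by split=> [|a b]; apply/val_inj/funext => x; rewrite /= (rmorph1, rmorphM).
Qed.

HB.instance Definition _ := GRing.isZmodMorphism.Build R qalg qscal qscal_zmod.
HB.instance Definition _ :=
  GRing.isMonoidMorphism.Build R qalg qscal qscal_monoid.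

Lemma qbase_subproof k : (fun x : W => val (rbase x) 0 k) \in descended.
Proof.
apply/asboolP; split => [i|x]; last by rewrite /= mxE.
exists 'X_(lshift _ (lshift _ k)) => x _.
by rewrite mevalXU /= !row_mxEl.
Qed.

Definition qbase (k : 'I_3) : qalg := exist _ (fun x : W => val (rbase x) 0 k) (qbase_subproof k).

Lemma qbase_sphere : \sum_(k < 3) qbase k ^+ 2 = 1.
Proof.
apply/val_inj/funext => x; rewrite rmorph_sum fct_sumE /=.
rewrite -[RHS](eqP (valP (rbase x))); apply: eq_bigr => k _.
by rewrite expr2.
Qed.

Definition quotient_bundle : real_bundle R :=
  @RealBundle R qalg qscal qbase qbase_sphere (fun b => @rfiblin R D (val b)).

End Quotient.

(* A vector bundle with affine total space over the complex sphere.  The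
   functions that are linear on the fibres record the vector space structure of
   the fibres (the total space is the spectrum of the symmetric algebra of the
   module they form). *)
Record sphere_bundle (R : realType) := SphereBundle {
  stot :> Type;
  sproj : stot -> S2 R;
  sreg : (stot -> R[i]) -> Prop;
  slin : (stot -> R[i]) -> Prop
}.

Definition bundle_iso (R : realType) (E F : sphere_bundle R) (f : E -> F) : Prop :=
  [/\ bijective f,
      forall e, sproj (f e) = sproj e,
      forall g, sreg g <-> sreg (g \o f)
    & forall g, slin g <-> slin (g \o f)].

(* On an affine variety, an involution is anti-regular (an involution of
   R-schemes lifting tau) when f |-> conj o f o s preserves regular functions. *)
Definition real_structure (R : realType) (E : sphere_bundle R) (s : E -> E) : Prop :=
  involutive s /\ forall g : E -> R[i], sreg g -> sreg (fun e => (g (s e))^*).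

(* The complexification of an affine real variety Spec B: its points are the
   homomorphisms of R-algebras from B to C, its functions are those of
   B (x)_R C, and its canonical real structure composes with conjugation. *)
Section Complexification.
Variables (R : realType) (V : real_bundle R).
Local Notation C := R[i].

Record cpoint := CPoint {
  ceval :> {rmorphism balg V -> C};
  ceval_scal : forall a : R, ceval (bscal V a) = a%:C%C
}.

Lemma cproj_subproof (phi : cpoint) :
  \sum_(k < 3) (\row_(k < 3) phi (bbase V k)) 0 k ^+ 2 == 1.
Proof.
rewrite -(rmorph1 phi) -(bbase_sphere V) rmorph_sum; apply/eqP/eq_bigr => k _.
by rewrite mxE rmorphXn.
Qed.

Definition cproj (phi : cpoint) : S2 R := 
  exist _ (\row_(k < 3) phi (bbase V k)) (cproj_subproof phi).

Definition complexification : sphere_bundle R :=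
  SphereBundle cproj
    (fun g => exists b c : balg V, forall phi : cpoint, g phi = phi b + 'i * phi c)
    (fun g => exists b c : balg V,
       [/\ blin b, blin c & forall phi : cpoint, g phi = phi b + 'i * phi c]).

Lemma cconj_subproof (phi : cpoint) (a : R) :
  (Num.conj \o phi) (bscal V a) = a%:C%C.
Proof. by rewrite /= ceval_scal; exact: conjc_real. Qed.

Definition canonical_real_structure (phi : complexification) : complexification :=
  @CPoint (Num.conj \o (phi : cpoint)) (cconj_subproof phi).

End Complexification.

Definition Vn (R : realType) (n : nat) : real_bundle R := quotient_bundle (Ln R n).

Section TrivialBundle.
Variable R : realType.
Local Notation C := R[i].

Definition trivial2 : sphere_bundle R :=
  @SphereBundle R (S2 R * 'cV[C]_2)%type fst
    (poly_on xpredT (fun sv => row_mx (val sv.1) sv.2^T))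
    (linpoly_on xpredT (fun sv => val sv.1) (fun sv => sv.2^T)).

(* A is in GL_2 of the ring of regular functions on the complex sphere. *)
Definition S2_GL2 (A : S2 R -> 'M[C]_2) : Prop :=
  (forall i j, S2reg (fun s => A s i j)) /\
  exists B : S2 R -> 'M[C]_2,
    (forall i j, S2reg (fun s => B s i j)) /\
    forall s, A s *m B s = 1%:M /\ B s *m A s = 1%:M.

Definition mx_act (A : S2 R -> 'M[C]_2) (sv : trivial2) : trivial2 :=
  (sv.1, A sv.1 *m sv.2).

Definition Sigma0 (sv : trivial2) : trivial2 := (sigmaS2 sv.1, conj_mx sv.2).

Variables (n : nat) (P Q : {poly R}).

Definition An (s : S2 R) : 'M[C]_2 :=
  let x := val s 0 0 in let y := val s 0 1 in let z := val s 0 2 in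
  let p := (map_poly (real_complex R) P).[z] in
  let q := (map_poly (real_complex R) Q).[z] in
  \matrix_(i < 2, j < 2)
    if i == 0 then
      if j == 0 then (x - 'i * y) ^+ n * (p + q)
      else (1 - z) ^+ n - (1 + z) ^+ n
    else
      if j == 0 then - ((1 + z) ^+ n * p ^+ 2) + (1 - z) ^+ n * q ^+ 2
      else - ((x + 'i * y) ^+ n * (p + q)).

Definition Sigma (sv : trivial2) : trivial2 := mx_act An (Sigma0 sv).

End TrivialBundle.

(* Main.v *)
Require Import Defs.
From HB Require Import structures.
From mathcomp Require Import all_boot all_algebra reals complex.
From mathcomp Require Import generic_quotient boolp mpoly ring.

Set Implicit Arguments.
Unset Strict Implicit.
Unset Printing Implicit Defensive.

Import GRing.Theory Num.Theory.
Local Open Scope ring_scope.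
Local Open Scope quotient_scope.

(** Write a point of P^1 x P^1 as ([u], [v]), and let T = u0 v0 + u1 v1.  The
    sphere is the locus T <> 0, and there the functions 2 u_i v_j / T are
    1 + z, x + i y, x - i y and 1 - z ([over_sphere], [uv]).  Put a = (1 + z)^n
    and b = (1 - z)^n, so that a P + b Q = 1 and
    (x - i y)^n (x + i y)^n = a b.  These two relations give
    A_n(s) conj(A_n(sigma s)) = 1 ([An_mul_conj]), which says both that A_n is
    invertible and that Sigma_n is an involution.

    Over ([u], [v]), a point of L_n + sigma^* L_n is a pair (t, t'), where t has
    degree n with respect to u and t', after conjugation, has degree n with
    respect to v ([presents]).  With c = 2 / T, the functions
        g1 = c^n (t v0^n + t' u1^n),
        g2 = c^n (t v1^n Q - t' u0^n P)
    depend only on the point, and are linear on the fibres.  The determinant of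
    (t, t') |-> (g1, g2) is - c^n (a P + b Q) = - c^n, so this is a global
    frame; explicitly
        t = u0^n P g1 + u1^n g2,   t' = v1^n Q g1 - v0^n g2.
    The descent involution exchanges the roles of u and v and of t and t', up
    to conjugation, and the same relation turns this into multiplication by
    A_n ([frame_sigma]).

    The frame gives a bijection from the total space W over the sphere onto
    S^2 x A^2 ([trivialise]).  It identifies regular functions on both sides.
    On each chart of W, g1 and g2 are polynomials in the chart coordinates.
    Conversely the chart coordinates are polynomials in x, y, z, g1, g2 divided
    by powers of 1 + z or of 1 - z on two charts that cover the sphere; as 1 + z
    and 1 - z generate the unit ideal, a function that is regular on these two
    charts is a global polynomial ([rreg_trivialiseE], [rfiblin_trivialiseE]).

    It remains to see that the complexification of V_n is W.  Every regular
    function on W is b + i c with b and c invariant ([rreg_split]), because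
    Sigma_n is antiregular; so a homomorphism from the invariant functions to C
    extends to all polynomials in x, y, z, g1, g2, and is the evaluation at the
    point of W with the corresponding coordinates ([cpoint_eval]).  Under this
    identification the canonical real structure is the descent involution. *)

(** * Functions polynomial in given coordinates *)

Section Polynomials.
Variables (R : realType) (T : Type) (N : nat) (D : pred T).
Variable (c : T -> 'rV[R[i]]_N).
Local Notation C := R[i].
Implicit Types f g a : T -> C.

Lemma poly_on_ext f g :
  (forall x, D x -> f x = g x) -> poly_on D c f -> poly_on D c g.
Proof. by move=> fg [p Hp]; exists p => x Dx; rewrite -fg ?Hp. Qed.

Lemma poly_on_add f g :
  poly_on D c f -> poly_on D c g -> poly_on D c (fun x => f x + g x).
Proof.
by move=> [p Hp] [q Hq]; exists (p + q) => x Dx; rewrite mevalD Hp ?Hq.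
Qed.

Lemma poly_on_opp f : poly_on D c f -> poly_on D c (fun x => - f x).
Proof. by move=> [p Hp]; exists (- p) => x Dx; rewrite mevalN Hp. Qed.

Lemma poly_on_exp f k : poly_on D c f -> poly_on D c (fun x => f x ^+ k).
Proof. by move=> [p Hp]; exists (p ^+ k) => x Dx; rewrite rmorphXn /= Hp. Qed.

Lemma poly_on_horner f (p : {poly C}) :
  poly_on D c f -> poly_on D c (fun x => p.[f x]).
Proof.
move=> Hf; elim/poly_ind: p => [|p a Hp].
  by apply: poly_on_ext (poly_on_cst D c 0) => x _; rewrite horner0.
apply: poly_on_ext (poly_on_add (poly_on_mul Hp Hf) (poly_on_cst D c a)) => x _.
by rewrite hornerMXaddC.
Qed.

(** Induction on the way a polynomial function is built; this reduces every
    closure property of regular functions to the coordinates. *)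
Lemma poly_on_ind (S : (T -> C) -> Prop) :
  (forall f g, (forall x, D x -> f x = g x) -> S f -> S g) ->
  (forall a : C, S (fun=> a)) ->
  (forall f g, S f -> S g -> S (fun x => f x + g x)) ->
  (forall f g, S f -> S g -> S (fun x => f x * g x)) ->
  (forall k, S (fun x => c x 0 k)) ->
  forall f, poly_on D c f -> S f.
Proof.
move=> Sext Scst Sadd Smul Sc f [p Hp].
apply: (Sext (fun x => p.@[c x 0])) => [x Dx|]; first by rewrite Hp.
have Sexp g k : S g -> S (fun x => g x ^+ k).
  move=> Sg; elim: k => [|k IH]; first exact: Scst 1.
  by apply: Sext (Smul _ _ Sg IH) => x _; rewrite exprS.
have Sprod (m : 'X_{1..N}) (s : seq 'I_N) :
    S (fun x => \prod_(k <- s) c x 0 k ^+ m k).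
  elim: s => [|k s IH].
    by apply: Sext (Scst 1) => x _; rewrite big_nil.
  by apply: Sext (Smul _ _ (Sexp _ (m k) (Sc k)) IH) => x _; rewrite big_cons.
suff Ssum (s : seq 'X_{1..N}) :
    S (fun x => \sum_(m <- s) p@_m * \prod_(k < N) c x 0 k ^+ m k).
  by apply: Sext (Ssum (msupp p)) => x _; rewrite mevalE.
elim: s => [|m s IH].
  by apply: Sext (Scst 0) => x _; rewrite big_nil.
apply: Sext (Sadd _ _ (Smul _ _ (Scst p@_m) (Sprod m _)) IH) => x _.
by rewrite big_cons.
Qed.

Variables (r : nat) (l : T -> 'rV[C]_r).

Lemma linpoly_on_ext f g :
  (forall x, D x -> f x = g x) -> linpoly_on D c l f -> linpoly_on D c l g.
Proof. by move=> fg [p Hp]; exists p => x Dx; rewrite -fg ?Hp. Qed.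

Lemma linpoly_on0 : linpoly_on D c l (fun=> 0).
Proof.
exists (fun=> 0) => x _; rewrite big1 // => k _.
by rewrite rmorph0 mul0r.
Qed.

Lemma linpoly_on_add f g :
  linpoly_on D c l f -> linpoly_on D c l g ->
  linpoly_on D c l (fun x => f x + g x).
Proof.
move=> [p Hp] [q Hq]; exists (fun k => p k + q k) => x Dx.
rewrite Hp // Hq // -big_split; apply: eq_bigr => k _.
by rewrite mevalD mulrDl.
Qed.

Lemma linpoly_on_mul a f :
  poly_on D c a -> linpoly_on D c l f -> linpoly_on D c l (fun x => a x * f x).
Proof.
move=> [q Hq] [p Hp]; exists (fun k => q * p k) => x Dx.
rewrite Hp // Hq // big_distrr; apply: eq_bigr => k _.
by rewrite mevalM /= mulrA.
Qed.

Lemma linpoly_on_coord k : linpoly_on D c l (fun x => l x 0 k).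
Proof.
exists (fun j => (j == k)%:R) => x _.
rewrite (bigD1 k) //= eqxx rmorph1 mul1r big1 ?addr0 // => j /negPf ->.
by rewrite rmorph0 mul0r.
Qed.

Lemma linpoly_on_ind (S : (T -> C) -> Prop) :
  (forall f g, (forall x, D x -> f x = g x) -> S f -> S g) ->
  S (fun=> 0) ->
  (forall f g, S f -> S g -> S (fun x => f x + g x)) ->
  (forall a f, poly_on D c a -> S f -> S (fun x => a x * f x)) ->
  (forall k, S (fun x => l x 0 k)) ->
  forall f, linpoly_on D c l f -> S f.
Proof.
move=> Sext S0 Sadd Smul Sl f [p Hp].
apply: (Sext (fun x => \sum_(k < r) (p k).@[c x 0] * l x 0 k)) => [x Dx|].
  by rewrite Hp.
elim: (index_enum _) => [|k s IH].
  by apply: Sext S0 => x _; rewrite big_nil.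
have Sk : S (fun x => (p k).@[c x 0] * l x 0 k) by apply: Smul => //; exists (p k).
by apply: Sext (Sadd _ _ Sk IH) => x _; rewrite big_cons.
Qed.

End Polynomials.

Section Substitution.
Variables (R : realType) (T : Type).
Local Notation C := R[i].

(** Substitution of polynomials into a polynomial: a change of coordinates by
    polynomials preserves regularity. *)
Lemma poly_on_comp N M (D : pred T) (c : T -> 'rV[C]_N) (d : T -> 'rV[C]_M) f :
  (forall k, poly_on D c (fun x => d x 0 k)) -> poly_on D d f -> poly_on D c f.
Proof.
move=> dc; apply: poly_on_ind => //.
- by move=> g h; apply: poly_on_ext.
- exact: poly_on_cst.
- exact: poly_on_add.
- exact: poly_on_mul.
Qed.

Lemma linpoly_on_comp N M r q (D : pred T) (c : T -> 'rV[C]_N)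
    (d : T -> 'rV[C]_M) (l : T -> 'rV[C]_r) (m : T -> 'rV[C]_q) f :
  (forall k, poly_on D c (fun x => d x 0 k)) ->
  (forall k, linpoly_on D c l (fun x => m x 0 k)) ->
  linpoly_on D d m f -> linpoly_on D c l f.
Proof.
move=> dc ml; apply: linpoly_on_ind => //.
- by move=> g h; apply: linpoly_on_ext.
- exact: linpoly_on0.
- exact: linpoly_on_add.
- move=> a g ad; apply: linpoly_on_mul; exact: poly_on_comp ad.
Qed.

Lemma poly_on_pullback (U : Type) (h : U -> T) N (c : T -> 'rV[C]_N) f :
  poly_on xpredT c f -> poly_on xpredT (c \o h) (f \o h).
Proof. by move=> [p Hp]; exists p => x _; apply: Hp. Qed.

Lemma linpoly_on_pullback (U : Type) (h : U -> T) N r (c : T -> 'rV[C]_N)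
    (l : T -> 'rV[C]_r) f :
  linpoly_on xpredT c l f -> linpoly_on xpredT (c \o h) (l \o h) (f \o h).
Proof. by move=> [p Hp]; exists p => x _; apply: Hp. Qed.

Lemma poly_on_conj N (D : pred T) (c : T -> 'rV[C]_N) f :
  poly_on D c f -> poly_on D (fun x => conj_mx (c x)) (fun x => (f x)^*).
Proof.
apply: (poly_on_ind (S := fun f => poly_on D _ (fun x => (f x)^*))).
- by move=> g h gh; apply: poly_on_ext => x /gh ->.
- by move=> a; apply: poly_on_cst.
- by move=> g h Hg Hh; apply: poly_on_ext (poly_on_add Hg Hh) => x _; rewrite rmorphD.
- by move=> g h Hg Hh; apply: poly_on_ext (poly_on_mul Hg Hh) => x _; rewrite rmorphM.
- by move=> k; apply: poly_on_ext (poly_on_coord _ _ k) => x _; rewrite mxE.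
Qed.

Lemma linpoly_on_conj N r (D : pred T) (c : T -> 'rV[C]_N) (l : T -> 'rV[C]_r) f :
  linpoly_on D c l f ->
  linpoly_on D (fun x => conj_mx (c x)) (fun x => conj_mx (l x)) (fun x => (f x)^*).
Proof.
apply: (linpoly_on_ind (S := fun f => linpoly_on D _ _ (fun x => (f x)^*))).
- by move=> g h gh; apply: linpoly_on_ext => x /gh ->.
- by apply: linpoly_on_ext (linpoly_on0 _ _ _) => x _; rewrite conjC0.
- by move=> g h Hg Hh; apply: linpoly_on_ext (linpoly_on_add Hg Hh) => x _; rewrite rmorphD.
- move=> a g Ha Hg; apply: linpoly_on_ext (linpoly_on_mul (poly_on_conj Ha) Hg) => x _.
  by rewrite rmorphM.
- by move=> k; apply: linpoly_on_ext (linpoly_on_coord _ _ _ k) => x _; rewrite mxE.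
Qed.

End Substitution.

(** * The sphere, the matrices A_n and the real structure Sigma_n *)

Lemma conj_mxE (R : realType) m n (A : 'M[R[i]]_(m, n)) i j :
  conj_mx A i j = (A i j)^*.
Proof. by rewrite mxE. Qed.

Lemma conj_mxZ (R : realType) m n (a : R[i]) (A : 'M[R[i]]_(m, n)) :
  conj_mx (a *: A) = a^* *: conj_mx A.
Proof. exact: map_mxZ. Qed.

Lemma I2_case (k : 'I_2) : k = 0 \/ k = 1.
Proof. by case: k => [[|[|//]] ?]; [left|right]; apply: val_inj. Qed.

Lemma sum_I2 (V : nmodType) (F : 'I_2 -> V) : \sum_(k < 2) F k = F 0 + F 1.
Proof. by rewrite !big_ord_recl big_ord0 addr0; congr (_ + F _); apply: val_inj. Qed.

Section Sphere.
Variable R : realType.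
Local Notation C := R[i].
Implicit Types (s : S2 R) (p : {poly R}).

(** These are the values of 2 u_i v_j / (u0 v0 + u1 v1) at the point of the sphere
    that has homogeneous coordinates ([u], [v]). *)
Definition uv (i j : 'I_2) s : C :=
  if i == 0 then if j == 0 then 1 + val s 0 2 else val s 0 0 + 'i * val s 0 1
  else if j == 0 then val s 0 0 - 'i * val s 0 1 else 1 - val s 0 2.

Definition height p s : C := (map_poly (real_complex R) p).[val s 0 2].

(** The equation of the sphere, read on P^1 x P^1 as (u0 v1) (u1 v0) = (u0 v0) (u1 v1). *)
Lemma uv_det s : uv 0 1 s * uv 1 0 s = uv 0 0 s * uv 1 1 s.
Proof.
have := eqP (valP s); rewrite !big_ord_recl big_ord0 addr0.
have -> : lift ord0 ord0 = 1 :> 'I_3 by apply: val_inj.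
have -> : lift ord0 (lift ord0 ord0) = 2 :> 'I_3 by apply: val_inj.
rewrite -[ord0]/(0 : 'I_3) /uv /= => e.
have key (K : comNzRingType) (I x y z : K) : I ^+ 2 = -1 ->
    x ^+ 2 + (y ^+ 2 + z ^+ 2) = 1 ->
    (x + I * y) * (x - I * y) = (1 + z) * (1 - z).
  move=> I2 /(canRL (addrK _)) x2; ring: I2 x2.
exact: key (sqrCi _) e.
Qed.

Lemma uv_sigma i j s : uv i j (sigmaS2 s) = (uv j i s)^*.
Proof.
rewrite /uv /= !mxE.
case: (I2_case i) => ->; case: (I2_case j) => ->;
  by rewrite /= ?(rmorphD, rmorphN, rmorphM, rmorph1) /= ?conjCi ?mulNr ?opprK.
Qed.

Lemma uv_trace s : uv 0 0 s + uv 1 1 s = 2.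
Proof. by rewrite /uv /=; ring. Qed.

Lemma height_sigma p s : height p (sigmaS2 s) = (height p s)^*.
Proof.
rewrite /height /= mxE -horner_map -map_poly_comp; congr (_.[_]).
by apply: eq_map_poly => a /=; rewrite -[LHS]conjc_real.
Qed.

Lemma poly_on_sphere T N (D : pred T) (c : T -> 'rV[C]_N) (h : T -> S2 R) f :
  (forall k, poly_on D c (fun x => val (h x) 0 k)) -> S2reg f ->
  poly_on D c (f \o h).
Proof.
move=> hc [p Hp]; apply: (@poly_on_comp _ _ _ _ _ _ (fun x => val (h x))) => //.
by exists p => x _; apply: Hp.
Qed.

Lemma S2reg_coord k : S2reg (fun s : S2 R => val s 0 k).
Proof. exact: poly_on_coord. Qed.

Lemma S2reg_uv i j : S2reg (uv i j).
Proof.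
have [x y z] : [/\ S2reg (fun s : S2 R => val s 0 0),
    S2reg (fun s : S2 R => 'i * val s 0 1) & S2reg (fun s : S2 R => val s 0 2)].
  by split; [| apply: poly_on_mul; first exact: poly_on_cst |]; exact: S2reg_coord.
rewrite /uv; case: (i == 0); case: (j == 0); rewrite /S2reg.
- exact: poly_on_add (poly_on_cst _ _ 1) z.
- exact: poly_on_add.
- exact: poly_on_add (poly_on_opp _).
- exact: poly_on_add (poly_on_cst _ _ 1) (poly_on_opp z).
Qed.

Lemma S2reg_height p : S2reg (height p).
Proof. exact: poly_on_horner (S2reg_coord 2). Qed.

(** 1 + z and 1 - z generate the unit ideal, hence so do their powers: the partition
    of unity with which regular functions are glued. *)
Lemma uv_bezout (N M : nat) : exists a b : S2 R -> C,
  [/\ S2reg a, S2reg b & forall s, a s * uv 0 0 s ^+ N + b s * uv 1 1 s ^+ M = 1].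
Proof.
have cop : coprimep (1 + 'X : {poly C}) (1 - 'X).
  (* (1 + z) + (1 - z) = 2. *)
  apply/Bezout_eq1_coprimepP; exists (2^-1%:P, 2^-1%:P) => /=.
  rewrite -mulrDr.
  have -> : 1 + 'X + (1 - 'X) = 2%:P :> {poly C}.
    by rewrite polyCMn; ring.
  by rewrite -polyCM mulVf ?pnatr_eq0.
have /Bezout_eq1_coprimepP[[a b] /= ab] :=
  coprimep_expl N (coprimep_expr M cop).
exists (fun s => a.[val s 0 2]), (fun s => b.[val s 0 2]); split.
- exact: poly_on_horner (S2reg_coord 2).
- exact: poly_on_horner (S2reg_coord 2).
move=> s; have := congr1 (horner^~ (val s 0 2)) ab.
by rewrite /uv /= !hornerE.
Qed.

Variables (n : nat) (P Q : {poly R}).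
Hypothesis PQ : (1 + 'X) ^+ n * P + (1 - 'X) ^+ n * Q = 1.

Lemma height_bezout s :
  uv 0 0 s ^+ n * height P s + uv 1 1 s ^+ n * height Q s = 1.
Proof.
have := congr1 (fun p => (map_poly (real_complex R) p).[val s 0 2]) PQ.
rewrite /= !(rmorphM, rmorphD, rmorphXn, rmorphN, rmorph1) /= map_polyX.
by rewrite !hornerE.
Qed.

Lemma AnE s : An n P Q s = \matrix_(i < 2, j < 2)
    if i == 0 then
      if j == 0 then uv 1 0 s ^+ n * (height P s + height Q s)
      else uv 1 1 s ^+ n - uv 0 0 s ^+ n
    else
      if j == 0 then
        - (uv 0 0 s ^+ n * height P s ^+ 2) + uv 1 1 s ^+ n * height Q s ^+ 2
      else - (uv 0 1 s ^+ n * (height P s + height Q s)).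
Proof. by []. Qed.

(** Conjugation exchanges x + i y with x - i y and fixes the real polynomials in z,
    so only the diagonal entries of the matrix change. *)
Lemma conj_AnE s : conj_mx (An n P Q (sigmaS2 s)) = \matrix_(i < 2, j < 2)
    if i == 0 then
      if j == 0 then uv 0 1 s ^+ n * (height P s + height Q s)
      else uv 1 1 s ^+ n - uv 0 0 s ^+ n
    else
      if j == 0 then
        - (uv 0 0 s ^+ n * height P s ^+ 2) + uv 1 1 s ^+ n * height Q s ^+ 2
      else - (uv 1 0 s ^+ n * (height P s + height Q s)).
Proof.
apply/matrixP => i j; rewrite AnE !mxE !uv_sigma !height_sigma.
by case: (i == 0); case: (j == 0);
  rewrite !(rmorphM, rmorphD, rmorphB, rmorphN, rmorphXn) /= ?conjCK.
Qed.

(** This is both the invertibility of A_n and the cocycle condition that makes Sigma_n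
    an involution.  It follows from (x - i y)^n (x + i y)^n = (1 - z^2)^n and from the
    Bezout relation between P and Q. *)
Lemma An_mul_conj s : An n P Q s *m conj_mx (An n P Q (sigmaS2 s)) = 1%:M.
Proof.
(* The diagonal entries are both (a p + b q) ^ 2. *)
have key (K : comNzRingType) (a b x y p q : K) :
    y * x = a * b -> a * p + b * q = 1 ->
  [/\ x * (p + q) * (y * (p + q)) + (b - a) * (- (a * p ^+ 2) + b * q ^+ 2) = 1,
      x * (p + q) * (b - a) + (b - a) * (- (x * (p + q))) = 0,
      (- (a * p ^+ 2) + b * q ^+ 2) * (y * (p + q)) +
         (- (y * (p + q))) * (- (a * p ^+ 2) + b * q ^+ 2) = 0
    & (- (a * p ^+ 2) + b * q ^+ 2) * (b - a) +
         (- (y * (p + q))) * (- (x * (p + q))) = 1].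
  move=> xy e; have e2 : (a * p + b * q) ^+ 2 = 1 by rewrite e expr1n.
  split; last (rewrite -e2; ring: xy); try by ring.
  by rewrite -e2; ring: xy.
have xy : uv 0 1 s ^+ n * uv 1 0 s ^+ n = uv 0 0 s ^+ n * uv 1 1 s ^+ n.
  by rewrite -!exprMn uv_det.
have [k00 k01 k10 k11] := key _ _ _ _ _ _ _ xy (height_bezout s).
apply/matrixP => i j; rewrite conj_AnE AnE !mxE sum_I2 !mxE /=.
by case: (I2_case i) => ->; case: (I2_case j) => ->.
Qed.

Lemma S2reg_An i j : S2reg (fun s => An n P Q s i j).
Proof.
have reg k l : S2reg (fun s => uv k l s ^+ n) by apply/poly_on_exp/S2reg_uv.
have regPQ : S2reg (fun s => height P s + height Q s).
  by apply: poly_on_add; apply: S2reg_height.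
have reg2 p : S2reg (fun s => height p s ^+ 2) by apply/poly_on_exp/S2reg_height.
have : S2reg (fun s => if i == 0 then
      if j == 0 then uv 1 0 s ^+ n * (height P s + height Q s)
      else uv 1 1 s ^+ n - uv 0 0 s ^+ n
    else
      if j == 0 then
        - (uv 0 0 s ^+ n * height P s ^+ 2) + uv 1 1 s ^+ n * height Q s ^+ 2
      else - (uv 0 1 s ^+ n * (height P s + height Q s))).
  case: (i == 0); case: (j == 0).
  - exact: poly_on_mul (reg 1 0) regPQ.
  - exact: poly_on_sub (reg 1 1) (reg 0 0).
  - apply: poly_on_add; first apply: poly_on_opp.
      exact: poly_on_mul (reg 0 0) (reg2 P).
    exact: poly_on_mul (reg 1 1) (reg2 Q).
  - apply: poly_on_opp; exact: poly_on_mul (reg 0 1) regPQ.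
by apply: poly_on_ext => s _; rewrite AnE mxE.
Qed.

Lemma S2reg_conj f : S2reg f -> S2reg (fun s => (f (sigmaS2 s))^*).
Proof.
move=> /(poly_on_pullback (@sigmaS2 R)) /poly_on_conj.
apply: poly_on_comp => k; apply: poly_on_ext (S2reg_coord k) => s _ /=.
by rewrite conj_mxK.
Qed.

Lemma An_GL2 : S2_GL2 (An n P Q).
Proof.
split; first exact: S2reg_An.
exists (fun s => conj_mx (An n P Q (sigmaS2 s))); split.
  move=> i j; apply: poly_on_ext (S2reg_conj (S2reg_An i j)) => s _.
  by rewrite conj_mxE.
by move=> s; split; [|apply: mulmx1C]; apply: An_mul_conj.
Qed.

Lemma SigmaK : involutive (Sigma n P Q).
Proof.
case=> s v; rewrite /Sigma /Sigma0 /mx_act /= sigmaS2K; congr (_, _).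
by rewrite {1}/conj_mx map_mxM mulmxA An_mul_conj mul1mx -/(conj_mx _) conj_mxK.
Qed.

End Sphere.

(** * Coordinates on total spaces, and antiregularity of Sigma_n *)

Section TotalCoordinates.
Variables (R : realType) (T : Type) (N r : nat) (D : pred T).
Variables (c : T -> 'rV[R[i]]_N) (l : T -> 'rV[R[i]]_r).

Lemma poly_on_row_base k : poly_on D (fun x => row_mx (c x) (l x)) (fun x => c x 0 k).
Proof.
apply: poly_on_ext (poly_on_coord _ _ (lshift r k)) => x _.
by rewrite row_mxEl.
Qed.

Lemma poly_on_row_fib k : poly_on D (fun x => row_mx (c x) (l x)) (fun x => l x 0 k).
Proof.
apply: poly_on_ext (poly_on_coord _ _ (rshift N k)) => x _.
by rewrite row_mxEr.
Qed.

Lemma poly_on_row f :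
  poly_on D c f -> poly_on D (fun x => row_mx (c x) (l x)) f.
Proof. by apply: poly_on_comp => k; apply: poly_on_row_base. Qed.

Lemma linpoly_poly_on f :
  linpoly_on D c l f -> poly_on D (fun x => row_mx (c x) (l x)) f.
Proof.
apply: linpoly_on_ind.
- by move=> g h; apply: poly_on_ext.
- exact: poly_on_cst 0.
- exact: poly_on_add.
- by move=> a g /poly_on_row; apply: poly_on_mul.
- exact: poly_on_row_fib.
Qed.

Lemma row_coord_ind N1 N2 (a : T -> 'rV[R[i]]_N1) (b : T -> 'rV[R[i]]_N2)
    (S : (T -> R[i]) -> Prop) :
  (forall f g, f =1 g -> S f -> S g) ->
  (forall k, S (fun x => a x 0 k)) -> (forall k, S (fun x => b x 0 k)) ->
  forall k, S (fun x => row_mx (a x) (b x) 0 k).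
Proof.
move=> Sext Sa Sb k; case: (split_ordP k) => j ->.
- by apply: Sext (Sa j) => x; rewrite row_mxEl.
- by apply: Sext (Sb j) => x; rewrite row_mxEr.
Qed.

Lemma poly_on_row_coords N1 N2 (a : T -> 'rV[R[i]]_N1) (b : T -> 'rV[R[i]]_N2) :
  (forall k, poly_on D c (fun x => a x 0 k)) ->
  (forall k, poly_on D c (fun x => b x 0 k)) ->
  forall k, poly_on D c (fun x => row_mx (a x) (b x) 0 k).
Proof. by apply: row_coord_ind => f g fg; apply: poly_on_ext => x _. Qed.

End TotalCoordinates.

Section AntiregularSigma.
Variables (R : realType) (n : nat) (P Q : {poly R}).
Local Notation C := R[i].
Local Notation Sig := (Sigma n P Q).

Lemma conj_Sigma_base (sv : trivial2 R) k :
  conj_mx (val (Sig sv).1) 0 k = val sv.1 0 k.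
Proof. by rewrite /= conj_mxK. Qed.

Lemma linpoly_on_conj_Sigma_fib k :
  @linpoly_on R (trivial2 R) _ _ xpredT (fun sv => val sv.1) (fun sv => sv.2^T)
    (fun sv => conj_mx ((Sig sv).2^T) 0 k).
Proof.
have reg i j : S2reg (fun s => conj_mx (An n P Q (sigmaS2 s)) i j).
  by apply: poly_on_ext (S2reg_conj (S2reg_An n P Q i j)) => s _; rewrite conj_mxE.
have lin j : @linpoly_on R (trivial2 R) _ _ xpredT (fun sv => val sv.1)
    (fun sv => sv.2^T)
    (fun sv => conj_mx (An n P Q (sigmaS2 sv.1)) k j * sv.2^T 0 j).
  apply: linpoly_on_mul; last exact: linpoly_on_coord.
  exact: poly_on_pullback (reg k j).
apply: linpoly_on_ext (linpoly_on_add (lin 0) (lin 1)) => -[s v] _ /=.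
rewrite [RHS]conj_mxE [(_ *m _)^T 0 k]mxE [(_ *m _) k 0]mxE.
by rewrite sum_I2 rmorphD !rmorphM /= -!conj_mxE conj_mxK ![v^T _ _]mxE.
Qed.

(** Sigma_n followed by conjugation of the coordinates is polynomial, with coefficients
    those of A_n conjugated. *)
Lemma sreg_Sigma (g : trivial2 R -> C) :
  sreg g -> sreg (fun e : trivial2 R => (g (Sig e))^*).
Proof.
move=> /(poly_on_pullback (Sig : trivial2 R -> trivial2 R)) /poly_on_conj.
apply: poly_on_comp => k /=.
have kE sv : conj_mx (row_mx (val (sigmaS2 sv.1)) (Sig sv).2^T) 0 k =
    row_mx (val sv.1) (conj_mx ((Sig sv).2^T)) 0 k.
  by rewrite /conj_mx map_row_mx -/(conj_mx _) /= conj_mxK.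
apply: poly_on_ext (fun sv _ => esym (kE sv)) _.
apply: poly_on_row_coords => j; first exact: poly_on_row_base.
exact: linpoly_poly_on (linpoly_on_conj_Sigma_fib j).
Qed.

Lemma slin_Sigma (g : trivial2 R -> C) :
  slin g -> slin (fun e : trivial2 R => (g (Sig e))^*).
Proof.
move=> /(linpoly_on_pullback (Sig : trivial2 R -> trivial2 R)) /linpoly_on_conj.
apply: linpoly_on_comp => k; last exact: linpoly_on_conj_Sigma_fib.
by apply: poly_on_ext (poly_on_coord _ _ k) => sv _; rewrite conj_Sigma_base.
Qed.

End AntiregularSigma.

(** * The quadric as a product of projective lines, and the line bundle O(n) *)

Section Quadric.
Variable R : realType.
Local Notation C := R[i].
Implicit Types (u v : 'rV[C]_2) (s : S2 R).

Lemma topt_eqP N (u v : 'rV[C]_N.+1) (u0 : u != 0) (v0 : v != 0) :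
  topt u0 = topt v0 <-> exists l : C, l != 0 /\ v = l *: u.
Proof.
split=> [|[l [l0 e]]]; last exact: eq_topt l0 e.
by move=> /eqmodP /asboolP[l [l0]]; rewrite !SubK => e; exists l.
Qed.

Lemma hcoord_normalized N (u : 'rV[C]_N.+1) (u0 : u != 0) (i : 'I_N.+1) :
  (hcoord (topt u0) 0 i)^-1 *: hcoord (topt u0) = (u 0 i)^-1 *: u.
Proof.
have [l [l0 ->]] := hcoord_topt u0.
by rewrite mxE scalerA invfM mulrAC mulVf // mul1r.
Qed.

Lemma hcoord_topt_eq0 N (u : 'rV[C]_N.+1) (u0 : u != 0) (i : 'I_N.+1) :
  (hcoord (topt u0) 0 i == 0) = (u 0 i == 0).
Proof.
have [l [l0 ->]] := hcoord_topt u0.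
by rewrite mxE mulf_eq0 (negPf l0).
Qed.

Definition dot u v : C := u 0 0 * v 0 0 + u 0 1 * v 0 1.

(** The pair ([u], [v]) corresponds to s under psi.  The equations are stated without
    dividing by T = dot u v, so that they can be checked for arbitrary vectors. *)
Definition over_sphere s u v : Prop :=
  dot u v != 0 /\ forall i j, dot u v * uv i j s = 2 * (u 0 i * v 0 j).

(** The coordinates of psi, combined as T + Z, X + i Y, X - i Y and T - Z, are the
    products 2 u_i v_j. *)
Lemma psi_S2P s u v (u0 : u != 0) (v0 : v != 0) :
  psi (topt u0, topt v0) = S2_in_P3 s <-> over_sphere s u v.
Proof.
have [a [a0 ea]] := hcoord_topt u0; have [b [b0 eb]] := hcoord_topt v0.
have -> : psi (topt u0, topt v0) = topt (psi_vec_neq0 u0 v0).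
  apply/esym/topt_eqP; exists (a * b); rewrite mulf_neq0 //=.
  by rewrite ea eb psi_vecZ.
have two0 : (2 : C) != 0 by rewrite pnatr_eq0.
have sqi : 'i * 'i = -1 :> C by rewrite -expr2 sqrCi.
have lE (l : C) (k : 'I_3) :
    (l *: row_mx (val s) 1 : 'rV_(3 + 1)) 0 (lshift 1 k) = l * val s 0 k.
  by rewrite mxE row_mxEl.
have rE (l : C) : (l *: row_mx (val s) 1 : 'rV_(3 + 1)) 0 (rshift 3 0) = l.
  by rewrite mxE row_mxEr mxE mulr1.
split=> [/esym/topt_eqP[l [l0 /rowP e]]|[T0 e]].
  have eT : dot u v = l by rewrite -[RHS]rE -e mxE.
  have := e (lshift 1 (2 : 'I_3)); have := e (lshift 1 (1 : 'I_3)).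
  have := e (lshift 1 (0 : 'I_3)).
  rewrite !lE -eT !mxE /= => e0 e1 e2; split; first by rewrite eT.
  move=> i j; rewrite /uv.
  case: (I2_case i) => ->; case: (I2_case j) => -> /=.
  - by rewrite mulrDr -e2 /dot; ring.
  - by rewrite mulrDr mulrCA -e0 -e1; ring: sqi.
  - by rewrite mulrBr mulrCA -e0 -e1; ring: sqi.
  - by rewrite mulrBr -e2 /dot; ring.
apply/esym/topt_eqP; exists (dot u v); split => //; apply/rowP => k.
move: (e 0 0) (e 0 1) (e 1 0) (e 1 1); rewrite /uv /= => e00 e01 e10 e11.
apply: (mulfI two0); case: (split_ordP (k : 'I_(3 + 1))) => j ->; last first.
  by rewrite ord1 rE mxE.
rewrite lE mxE; case: j => [[|[|[|//]]] lt] /=.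
- have -> : Ordinal lt = 0 by apply: val_inj.
  have -> : 2 * (u 0 0 * v 0 1 + u 0 1 * v 0 0) =
            2 * (u 0 0 * v 0 1) + 2 * (u 0 1 * v 0 0) by ring.
  by rewrite -e01 -e10; ring.
- have -> : Ordinal lt = 1 by apply: val_inj.
  have -> : 2 * ('i * (u 0 1 * v 0 0 - u 0 0 * v 0 1)) =
            'i * (2 * (u 0 1 * v 0 0) - 2 * (u 0 0 * v 0 1)) by ring.
  by rewrite -e01 -e10; ring: sqi.
- have -> : Ordinal lt = 2 by apply: val_inj.
  have -> : 2 * (u 0 0 * v 0 0 - u 0 1 * v 0 1) =
            2 * (u 0 0 * v 0 0) - 2 * (u 0 1 * v 0 1) by ring.
  by rewrite -e00 -e11; ring.
Qed.

Lemma over_sphere_neq0 s u v : over_sphere s u v -> u != 0 /\ v != 0.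
Proof.
by case=> T0 _; split; apply: contraNneq T0 => ->;
  rewrite /dot !mxE ?(mul0r, mulr0) addr0.
Qed.

(** The matrix [uv] at s has determinant 0 and trace 2, hence rank one; its factors are
    the homogeneous coordinates, so psi is onto the sphere. *)
Lemma over_sphere_exists s : exists u v, over_sphere s u v.
Proof.
have [k k0] : exists k, uv k k s != 0.
  have [e|] := eqVneq (uv 0 0 s) 0; last by exists 0.
  by exists 1; move: (uv_trace s); rewrite e add0r => ->; rewrite pnatr_eq0.
(* The column and the row through a nonzero diagonal entry. *)
exists (\row_i uv i k s), (\row_j uv k j s).
have d := uv_det s; have t := uv_trace s.
have eT : dot (\row_i uv i k s) (\row_j uv k j s) = 2 * uv k k s.
  rewrite /dot !mxE -t; move: d.
  by case: (I2_case k) => -> d; [rewrite [uv 1 0 s * _]mulrC d|rewrite d]; ring.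
split; first by rewrite eT mulf_neq0 ?pnatr_eq0.
move=> i j; rewrite eT !mxE -mulrA; congr (_ * _).
case: (I2_case i) => ->; case: (I2_case j) => ->; case: (I2_case k) => ->;
  ring: d.
Qed.

(** Divide by a nonzero coordinate of v: the left factor of a rank one matrix is one of
    its columns, up to a scalar. *)
Lemma rank1_unique (u v u' v' : 'rV[C]_2) (a a' : C) :
  a != 0 -> u != 0 -> v != 0 ->
  (forall i j, a * (u 0 i * v 0 j) = a' * (u' 0 i * v' 0 j)) ->
  exists l : C, l != 0 /\ u = l *: u'.
Proof.
move=> a0 u0 /rV0Pn[j vj] e.
have uE : u = (a' * v' 0 j / (a * v 0 j)) *: u'.
  apply/rowP => i; rewrite mxE; apply: (mulfI (mulf_neq0 a0 vj)).
  have -> : a * v 0 j * u 0 i = a * (u 0 i * v 0 j) by ring.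
  by rewrite e; field; rewrite a0 vj.
exists (a' * v' 0 j / (a * v 0 j)); split => //.
by apply: contraNneq u0 => l0; rewrite uE l0 scale0r.
Qed.

(** The factors of a rank one matrix are unique up to scalars, so psi is injective over
    the sphere. *)
Lemma over_sphere_unique s u v u' v' (u0 : u != 0) (v0 : v != 0)
    (u'0 : u' != 0) (v'0 : v' != 0) :
  over_sphere s u v -> over_sphere s u' v' ->
  topt u0 = topt u'0 /\ topt v0 = topt v'0.
Proof.
move=> [T0 e] [T'0 e'].
have key i j : dot u v * (u' 0 i * v' 0 j) = dot u' v' * (u 0 i * v 0 j).
  apply: (mulfI (_ : 2 != 0)); first by rewrite pnatr_eq0.
  by rewrite mulrCA -e' [RHS]mulrCA -e; ring.
split; apply/topt_eqP.
  exact: (rank1_unique T0 u'0 v'0 key).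
apply: (rank1_unique T0 v'0 u'0) => i j.
by rewrite mulrC [v' 0 i * _]mulrC -mulrC key [u 0 j * _]mulrC.
Qed.

End Quadric.

Section LineBundle.
Variables (R : realType) (n : nat).
Local Notation C := R[i].
Implicit Types (u v : 'rV[C]_2) (t : C).

(** The point of O(n) over [u] that takes the value t at u. *)
Definition On_pt u (u0 : u != 0) t : On R n :=
  \pi_(On R n) ((Sub u u0 : cone R 1), t).

Lemma On_pt_eqP u v (u0 : u != 0) (v0 : v != 0) t t' :
  On_pt u0 t = On_pt v0 t' <->
  exists l : C, [/\ l != 0, v = l *: u & t' = l ^+ n * t].
Proof.
split=> [/eqmodP /asboolP[l [l0]]|[l [l0 e e']]].
  by rewrite !SubK /= => e e'; exists l.
by apply/eqmodP/asboolP; exists l; rewrite !SubK.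
Qed.

Lemma On_pt_repr u (u0 : u != 0) t : exists l : C,
  [/\ l != 0, val (repr (On_pt u0 t)).1 = l *: u & (repr (On_pt u0 t)).2 = l ^+ n * t].
Proof.
have /eqmodP/asboolP[l [l0 e e']] : (Sub u u0, t) = repr (On_pt u0 t) %[mod On R n].
  by rewrite reprK.
by exists l; split => //; rewrite e SubK.
Qed.

Lemma On_base_pt u (u0 : u != 0) t : On_base (On_pt u0 t) = topt u0.
Proof.
have [l [l0 e _]] := On_pt_repr u0 t.
rewrite /On_base; have := valP (repr (On_pt u0 t)).1 => r0.
have -> : (repr (On_pt u0 t)).1 = Sub (val (repr (On_pt u0 t)).1) r0.
  by apply: val_inj; rewrite SubK.
by apply/esym/topt_eqP; exists l.
Qed.

(** Where the i-th coordinate of u vanishes both sides have the same default value,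
    because the representatives of a point differ by nonzero scalars. *)
Lemma On_coord_pt i u (u0 : u != 0) t : On_coord i (On_pt u0 t) = t / u 0 i ^+ n.
Proof.
have [l [l0 e e']] := On_pt_repr u0 t; rewrite /On_coord e e' mxE exprMn invfM.
by rewrite mulrACA mulfV ?mul1r // expf_neq0.
Qed.

Lemma On_pt_surj (e : On R n) u (u0 : u != 0) :
  On_base e = topt u0 -> exists t, e = On_pt u0 t.
Proof.
have r0 : val (repr e).1 != 0 := valP (repr e).1.
have eE : e = On_pt r0 (repr e).2.
  rewrite -[LHS]reprK /On_pt; congr (\pi _).
  by rewrite [LHS]surjective_pairing; congr (_, _); apply: val_inj; rewrite SubK.
rewrite {1}eE On_base_pt => /topt_eqP[l [l0 uE]].
exists (l ^+ n * (repr e).2); rewrite {1}eE; apply/On_pt_eqP.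
by exists l.
Qed.

End LineBundle.

(** * Homogeneous coordinates on the descended bundle *)

Section TotalSpace.
Variables (R : realType) (n : nat).
Local Notation C := R[i].
Local Notation D := (descent_bundle (Ln R n) (@sigmaP1P1 R)).
Local Notation W := (rtot D).
Implicit Types (u v : 'rV[C]_2) (t : C) (w : W).

Definition wpair w : (On R n * PN R 1) * (On R n * PN R 1) :=
  val ((val w).2 : dtot (Ln R n) (@sigmaP1P1 R)).

(** Homogeneous coordinates on W: t is the value at u of the component in L_n, and the
    conjugate of t' is the value at conj v of the component in sigma^* L_n.  With this
    conjugation t' is a linear coordinate for the complex structure of sigma^* L_n. *)
Definition presents w u v t t' : Prop :=
  exists (u0 : u != 0) (v0 : v != 0) (cu0 : conj_mx u != 0) (cv0 : conj_mx v != 0),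
    wpair w = ((On_pt n u0 t, topt v0), (On_pt n cv0 t'^*, topt cu0)).

Lemma topt_hcoord N (p : PN R N) (p0 : hcoord p != 0) : topt p0 = p.
Proof. by rewrite (bool_irrelevance p0 (hcoord_neq0 p)) toptK. Qed.

Lemma wpair_inj w w' : rbase w = rbase w' -> wpair w = wpair w' -> w = w'.
Proof.
move=> eb ep; apply: val_inj; apply: injective_projections => //.
exact: val_inj.
Qed.

Lemma wpairP w : ((On_base (wpair w).2.1, (wpair w).2.2) =
  sigmaP1P1 (On_base (wpair w).1.1, (wpair w).1.2)).
Proof. exact: eqP (valP ((val w).2 : dtot _ _)). Qed.

Lemma wpair_psi w : psi (On_base (wpair w).1.1, (wpair w).1.2) = S2_in_P3 (rbase w).
Proof. exact: eqP (valP w). Qed.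

Lemma presents_exists w : exists u v t t', presents w u v t t'.
Proof.
have := wpairP w; case e: (wpair w) => [[o1 p] [o2 q]] /= [eo2 eq].
have u0 := hcoord_neq0 (On_base o1); have v0 := hcoord_neq0 p.
have cu0 := conj_hcoord_neq0 (On_base o1); have cv0 := conj_hcoord_neq0 p.
have [t et] : exists t, o1 = On_pt n u0 t by apply: On_pt_surj; rewrite topt_hcoord.
have [t' et'] : exists t, o2 = On_pt n cv0 t.
  by apply: On_pt_surj; rewrite eo2; apply/topt_eqP; exists 1; rewrite oner_neq0 scale1r.
exists (hcoord (On_base o1)), (hcoord p), t, t'^*, u0, v0, cu0, cv0.
rewrite e conjCK -et -et' topt_hcoord; congr (_, (_, _)).
by rewrite eq; apply/topt_eqP; exists 1; rewrite oner_neq0 scale1r.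
Qed.

Lemma presents_over w u v t t' : presents w u v t t' -> over_sphere (rbase w) u v.
Proof.
case=> u0 [v0 [cu0 [cv0 e]]]; apply/(psi_S2P _ u0 v0).
by rewrite -wpair_psi e /= On_base_pt.
Qed.

Lemma presents_neq0 w u v t t' : presents w u v t t' -> u != 0 /\ v != 0.
Proof. by case=> u0 [v0 _]. Qed.

Lemma presents_build s u v t t' :
  over_sphere s u v -> exists2 w, rbase w = s & presents w u v t t'.
Proof.
move=> ov; have [u0 v0] := over_sphere_neq0 ov.
have cu0 : conj_mx u != 0 by rewrite conj_mx_eq0.
have cv0 : conj_mx v != 0 by rewrite conj_mx_eq0.
pose a : (On R n * PN R 1) * (On R n * PN R 1) :=
  ((On_pt n u0 t, topt v0), (On_pt n cv0 t'^*, topt cu0)).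
have ha : @aproj R _ (Ln R n) a.2 == sigmaP1P1 (@aproj R _ (Ln R n) a.1).
  by rewrite /= !On_base_pt /sigmaP1P1 /= (conj_topt u0 cu0) (conj_topt v0 cv0).
pose d : dtot (Ln R n) (@sigmaP1P1 R) := exist _ a ha.
have hd : psi (@aproj R _ D d) == S2_in_P3 s.
  by apply/eqP; rewrite /= On_base_pt; apply/psi_S2P.
exists (exist _ (s, d : atot D) hd) => //.
by exists u0, v0, cu0, cv0.
Qed.

Lemma presents_inj w w' u v t t' :
  rbase w = rbase w' -> presents w u v t t' -> presents w' u v t t' -> w = w'.
Proof.
move=> eb [u0 [v0 [cu0 [cv0 e]]]] [u0' [v0' [cu0' [cv0' e']]]].
apply: wpair_inj => //; rewrite e e'.
by rewrite (bool_irrelevance u0 u0') (bool_irrelevance v0 v0')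
  (bool_irrelevance cu0 cu0') (bool_irrelevance cv0 cv0').
Qed.

(** The degrees of homogeneity: t has degree n in u and t' has degree n in v. *)
Lemma presents_rescale w u v t t' u1 v1 t1 t1' :
  presents w u v t t' -> presents w u1 v1 t1 t1' ->
  exists a b : C, [/\ a != 0, b != 0 &
    [/\ u1 = a *: u, v1 = b *: v, t1 = a ^+ n * t & t1' = b ^+ n * t']].
Proof.
move=> [u0 [v0 [cu0 [cv0 e]]]] [u0' [v0' [cu0' [cv0' e']]]].
move: e'; rewrite e => -[/On_pt_eqP[a [a0 ua ta]] _ /On_pt_eqP[b [b0 vb tb]] _].
exists a, b^*; rewrite conjC_eq0; split => //; split => //.
  by rewrite -[LHS]conj_mxK vb /conj_mx map_mxZ -/(conj_mx _) -/(conj_mx _) conj_mxK.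
by rewrite -[LHS]conjCK tb rmorphM rmorphXn /= conjCK.
Qed.

(** Any choice of homogeneous coordinates of the base point can be completed in the
    fibre; this is what allows two points of one fibre to be compared. *)
Lemma presents_transfer w u v t t' u1 v1 : u1 != 0 -> v1 != 0 ->
  over_sphere (rbase w) u1 v1 ->
  presents w u v t t' -> exists t1 t1', presents w u1 v1 t1 t1'.
Proof.
move=> u1n0 v1n0 ov1 pw; have ov := presents_over pw.
case: pw => u0 [v0 [cu0 [cv0 e]]].
have [eu ev] := over_sphere_unique u0 v0 u1n0 v1n0 ov ov1.
have cu1 : conj_mx u1 != 0 by rewrite conj_mx_eq0.
have cv1 : conj_mx v1 != 0 by rewrite conj_mx_eq0.
have [t1 et1] : exists t1, On_pt n u0 t = On_pt n u1n0 t1.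
  by apply: On_pt_surj; rewrite On_base_pt.
have [t1' et1'] : exists t1, On_pt n cv0 t'^* = On_pt n cv1 t1.
  by apply: On_pt_surj; rewrite On_base_pt -(conj_topt v0) -(conj_topt v1n0) ev.
exists t1, t1'^*, u1n0, v1n0, cu1, cv1.
by rewrite e conjCK -et1 -et1' ev -(conj_topt u0) -(conj_topt u1n0) eu.
Qed.

Lemma rbase_sigmaW w : rbase (sigmaW w) = sigmaS2 (rbase w).
Proof. by []. Qed.

Lemma presents_sigma w u v t t' : presents w u v t t' ->
  presents (sigmaW w) (conj_mx v) (conj_mx u) t'^* t^*.
Proof.
move=> [u0 [v0 [cu0 [cv0 e]]]]; exists cv0, cu0.
rewrite !conj_mxK conjCK; exists v0, u0.
by rewrite /wpair /= in e *; rewrite e.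
Qed.

End TotalSpace.

(** * The global frame *)

Section Trivialisation.
Variables (R : realType) (n : nat) (P Q : {poly R}).
Local Notation C := R[i].
Local Notation W := (rtot (descent_bundle (Ln R n) (@sigmaP1P1 R))).
Implicit Types (u v : 'rV[C]_2) (t : C) (s : S2 R) (w : W).

(** The pair (g1, g2).  The entries have degree 0 in u and in v, because
    (2 / dot u v)^n compensates for the degree n of the brackets. *)
Definition frame s u v t t' : 'cV[C]_2 := \col_k
  ((2 / dot u v) ^+ n *
   if k == 0 then t * v 0 0 ^+ n + t' * u 0 1 ^+ n
   else t * v 0 1 ^+ n * height Q s - t' * u 0 0 ^+ n * height P s).

Lemma frame_rescale s u v t t' a b : a != 0 -> b != 0 ->
  frame s (a *: u) (b *: v) (a ^+ n * t) (b ^+ n * t') = frame s u v t t'.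
Proof.
move=> a0 b0; apply/colP => k; rewrite !mxE.
have -> : dot (a *: u) (b *: v) = a * b * dot u v by rewrite /dot !mxE; ring.
rewrite invfM mulrCA !exprMn exprVn exprMn.
have an0 : a ^+ n != 0 by rewrite expf_neq0.
have bn0 : b ^+ n != 0 by rewrite expf_neq0.
by case: (k == 0); field; rewrite an0 bn0.
Qed.

Lemma over_sphere_uv s u v i j : over_sphere s u v ->
  uv i j s = 2 / dot u v * (u 0 i * v 0 j).
Proof.
by move=> [T0 e]; apply: (mulfI T0); rewrite e; field.
Qed.

Hypothesis PQ : (1 + 'X) ^+ n * P + (1 - 'X) ^+ n * Q = 1.

(** The Bezout relation in homogeneous coordinates; up to a unit it is the determinant
    of the frame. *)
Lemma frame_bezout s u v : over_sphere s u v ->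
  (2 / dot u v) ^+ n * (u 0 0 ^+ n * v 0 0 ^+ n * height P s) +
  (2 / dot u v) ^+ n * (u 0 1 ^+ n * v 0 1 ^+ n * height Q s) = 1.
Proof.
move=> ov; rewrite -[RHS](height_bezout PQ s) !(over_sphere_uv _ _ ov).
by rewrite !exprMn; ring.
Qed.

(** Cramer's rule for the frame. *)
Lemma frame_solve s u v t t' (g := frame s u v t t') : over_sphere s u v ->
  t = u 0 0 ^+ n * height P s * g 0 0 + u 0 1 ^+ n * g 1 0 /\
  t' = v 0 1 ^+ n * height Q s * g 0 0 - v 0 0 ^+ n * g 1 0.
Proof.
move=> /frame_bezout e; rewrite /g !mxE /=.
by split; rewrite -[LHS]mulr1 -[X in _ * X = _]e; ring.
Qed.

Lemma frame_onto s u v (g : 'cV[C]_2) : over_sphere s u v ->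
  frame s u v (u 0 0 ^+ n * height P s * g 0 0 + u 0 1 ^+ n * g 1 0)
    (v 0 1 ^+ n * height Q s * g 0 0 - v 0 0 ^+ n * g 1 0) = g.
Proof.
move=> /frame_bezout e; apply/colP => k; rewrite mxE.
by case: (I2_case k) => -> /=; rewrite -[RHS]mulr1 -[X in _ = _ * X]e; ring.
Qed.

(** The matrix A_n is the matrix of the descent involution in the frame.  Each side is
    linear in conj t and conj t', and the coefficients agree once one side is multiplied
    by the Bezout relation. *)
Lemma frame_sigma s u v t t' : over_sphere s u v ->
  frame (sigmaS2 s) (conj_mx v) (conj_mx u) t'^* t^* =
  An n P Q (sigmaS2 s) *m conj_mx (frame s u v t t').
Proof.
move=> ov; have e := frame_bezout ov.
have uvE i j : uv i j (sigmaS2 s) = (2 / dot u v * (u 0 j * v 0 i))^*.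
  by rewrite uv_sigma (over_sphere_uv _ _ ov).
have dE : 2 / dot (conj_mx v) (conj_mx u) = (2 / dot u v)^*.
  rewrite fmorph_div rmorph_nat /=; congr (_ / _).
  by rewrite /dot !conj_mxE rmorphD !rmorphM /=; ring.
apply/colP => k; rewrite AnE [RHS]mxE sum_I2 !conj_mxE !(mxE, uvE, dE) !height_sigma.
have := congr1 Num.conj e; move: (2 / dot u v) => c.
rewrite conjC1 => ec.
by case: (I2_case k) => -> /=; rewrite -[LHS]mulr1 -[X in _ * X = _]ec;
  rewrite !(rmorphD, rmorphB, rmorphN, rmorphM, rmorphXn) /= !exprMn; ring.
Qed.

Lemma fibre_exists w :
  exists g, forall u v t t', presents w u v t t' -> g = frame (rbase w) u v t t'.
Proof.
have [u [v [t [t' pw]]]] := presents_exists w.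
exists (frame (rbase w) u v t t') => u1 v1 t1 t1' pw1.
have [a [b [a0 b0 [-> -> -> ->]]]] := presents_rescale pw pw1.
by rewrite frame_rescale.
Qed.

Definition fibre w : 'cV[C]_2 := projT1 (cid (fibre_exists w)).

Lemma fibreE w u v t t' :
  presents w u v t t' -> fibre w = frame (rbase w) u v t t'.
Proof. by rewrite /fibre; case: cid => g /= h; apply: h. Qed.

(** The trivialisation of E + sigma^* E over the sphere that the frame defines. *)
Definition trivialise w : trivial2 R := (rbase w, fibre w).

Lemma trivialise_inj : injective trivialise.
Proof.
move=> w w' [eb ef].
have [u [v [t [t' pw]]]] := presents_exists w.
have ov := presents_over pw; have [u0 v0] := presents_neq0 pw.
have [t2 [t2' pw']] : exists t1 t1', presents w' u v t1 t1'.
  have [u1 [v1 [t1 [t1' pw1]]]] := presents_exists w'.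
  by apply: presents_transfer pw1 => //; rewrite -eb.
have [et et'] := frame_solve t t' ov.
have ov' : over_sphere (rbase w') u v by rewrite -eb.
have [et2 et2'] := frame_solve t2 t2' ov'.
rewrite -(fibreE pw) in et et'; rewrite -(fibreE pw') -eb -ef -et -et' in et2 et2'.
by move: pw'; rewrite et2 et2'; apply: presents_inj.
Qed.

Lemma trivialise_surj (e : trivial2 R) : exists w, trivialise w = e.
Proof.
case: e => s g; have [u [v ov]] := over_sphere_exists s.
have [w ws pw] := presents_build n (u 0 0 ^+ n * height P s * g 0 0 + u 0 1 ^+ n * g 1 0)
  (v 0 1 ^+ n * height Q s * g 0 0 - v 0 0 ^+ n * g 1 0) ov.
by exists w; rewrite /trivialise (fibreE pw) ws frame_onto.
Qed.

Lemma trivialise_sigma w : trivialise (sigmaW w) = Sigma n P Q (trivialise w).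
Proof.
have [u [v [t [t' pw]]]] := presents_exists w.
rewrite /trivialise (fibreE (presents_sigma pw)) (fibreE pw) rbase_sigmaW.
by rewrite frame_sigma //; apply: presents_over pw.
Qed.

End Trivialisation.

(** * From functions on the trivial bundle to the charts *)

Section Fractions.
Variables (R : realType) (T : Type) (D : pred T) (d : T -> R[i]).
Local Notation C := R[i].
Implicit Types (S : (T -> C) -> Prop) (f g a h : T -> C).

(** On D, f becomes an element of S after multiplication by a power of d: the
    localisation of S at d, for functions that need not be defined by fractions. *)
Definition frac S f : Prop :=
  exists N h, S h /\ forall x, D x -> d x ^+ N * f x = h x.

Lemma frac_ext S f g : (forall x, D x -> f x = g x) -> frac S f -> frac S g.
Proof. by move=> fg [N [h [Sh e]]]; exists N, h; split=> // x Dx; rewrite -fg ?e. Qed.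

Lemma frac_incl S f : S f -> frac S f.
Proof. by exists 0, f; split=> // x _; rewrite mul1r. Qed.

Lemma frac_div S f h : S h -> (forall x, D x -> d x * f x = h x) -> frac S f.
Proof. by exists 1, h. Qed.

Lemma frac_sub (S S' : (T -> C) -> Prop) f :
  (forall h, S h -> S' h) -> frac S f -> frac S' f.
Proof. by move=> SS [N [h [Sh e]]]; exists N, h; split=> //; apply: SS. Qed.

Lemma frac_add S f g :
  (forall h, S h -> S (fun x => d x * h x)) ->
  (forall h k, S h -> S k -> S (fun x => h x + k x)) ->
  frac S f -> frac S g -> frac S (fun x => f x + g x).
Proof.
move=> Sd Sadd [N [h [Sh eh]]] [M [k [Sk ek]]].
have Sexp m p : S p -> S (fun x => d x ^+ m * p x).
  elim: m => [|m IH] Sp.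
    have -> : (fun x => d x ^+ 0 * p x) = p by apply/funext => x; rewrite mul1r.
    exact: Sp.
  have -> : (fun x => d x ^+ m.+1 * p x) = (fun x => d x * (d x ^+ m * p x)).
    by apply/funext => x; rewrite exprS mulrA.
  exact/Sd/IH.
exists (N + M)%N, (fun x => d x ^+ M * h x + d x ^+ N * k x).
split; first by apply: Sadd; apply: Sexp.
by move=> x Dx; rewrite -eh // -ek // exprD; ring.
Qed.

Lemma frac_mul (S S' : (T -> C) -> Prop) a f :
  (forall b h, S b -> S' h -> S' (fun x => b x * h x)) ->
  frac S a -> frac S' f -> frac S' (fun x => a x * f x).
Proof.
move=> SS [N [b [Sb eb]]] [M [h [Sh eh]]]; exists (N + M)%N, (fun x => b x * h x).
by split; [apply: SS|move=> x Dx; rewrite -eb // -eh // exprD; ring].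
Qed.

Variables (N : nat) (c : T -> 'rV[C]_N).
Hypothesis d_reg : poly_on xpredT c d.

Lemma frac_poly M (e : T -> 'rV[C]_M) f :
  (forall k, frac (poly_on xpredT c) (fun x => e x 0 k)) ->
  poly_on D e f -> frac (poly_on xpredT c) f.
Proof.
move=> fe; apply: poly_on_ind => //.
- exact: frac_ext.
- by move=> a; apply/frac_incl/poly_on_cst.
- by move=> g h; apply: frac_add; [move=> k; apply: poly_on_mul|apply: poly_on_add].
- by move=> g h; apply: frac_mul; apply: poly_on_mul.
Qed.

Lemma frac_linpoly M q r (e : T -> 'rV[C]_M) (m : T -> 'rV[C]_q)
    (l : T -> 'rV[C]_r) f :
  (forall k, frac (poly_on xpredT c) (fun x => e x 0 k)) ->
  (forall k, frac (linpoly_on xpredT c l) (fun x => m x 0 k)) ->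
  linpoly_on D e m f -> frac (linpoly_on xpredT c l) f.
Proof.
move=> fe fm; apply: linpoly_on_ind => //.
- exact: frac_ext.
- exact/frac_incl/linpoly_on0.
- by move=> g h; apply: frac_add; [move=> k; apply: linpoly_on_mul|apply: linpoly_on_add].
- by move=> a g /(frac_poly fe); apply: frac_mul; apply: linpoly_on_mul.
Qed.

End Fractions.

Section RegularFunctions.
Variables (R : realType) (n : nat) (P Q : {poly R}).
Hypothesis PQ : (1 + 'X) ^+ n * P + (1 - 'X) ^+ n * Q = 1.
Local Notation C := R[i].
Local Notation D := (descent_bundle (Ln R n) (@sigmaP1P1 R)).
Local Notation W := (rtot D).
Implicit Types (w : W) (k : 'I_2) (i : aidx D).

(** The coordinates u / u_k; below, chart2 is v / v_k, fib1 is t / u_k^n and fib2 is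
    t' / v_k^n.  They do not depend on the choice of homogeneous coordinates. *)
Definition chart1 k w : 'rV[C]_2 :=
  (hcoord (On_base (wpair w).1.1) 0 k)^-1 *: hcoord (On_base (wpair w).1.1).

Definition chart2 k w : 'rV[C]_2 :=
  (hcoord (wpair w).1.2 0 k)^-1 *: hcoord (wpair w).1.2.

Definition fib1 k w : C := On_coord k (wpair w).1.1.

Definition fib2 k w : C := (On_coord k (wpair w).2.1)^*.

Lemma chartsE w u v t t' : presents w u v t t' -> forall k,
  [/\ chart1 k w = (u 0 k)^-1 *: u, chart2 k w = (v 0 k)^-1 *: v,
      fib1 k w = t / u 0 k ^+ n & fib2 k w = t' / v 0 k ^+ n].
Proof.
move=> [u0 [v0 [cu0 [cv0 e]]]] k; rewrite /chart1 /chart2 /fib1 /fib2 e /=.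
rewrite On_base_pt !hcoord_normalized !On_coord_pt; split => //.
by rewrite rmorphM fmorphV rmorphXn /= !conj_mxE !conjCK.
Qed.

Lemma rdomE i w u v t t' : presents w u v t t' ->
  rdom i w = [&& u 0 i.1.1 != 0, v 0 i.1.2 != 0, v 0 i.2.1 != 0 & u 0 i.2.2 != 0].
Proof.
move=> [u0 [v0 [cu0 [cv0 e]]]].
have -> : rdom i w = [&& hcoord (On_base (wpair w).1.1) 0 i.1.1 != 0,
    hcoord (wpair w).1.2 0 i.1.2 != 0,
    hcoord (conj_proj (wpair w).1.2) 0 i.2.1 != 0 &
    hcoord (conj_proj (On_base (wpair w).1.1)) 0 i.2.2 != 0].
  by rewrite /rdom /= /wpair -andbA.
rewrite e /= On_base_pt (conj_topt _ cu0) (conj_topt _ cv0) !hcoord_topt_eq0.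
by rewrite !conj_mxE !conjC_eq0.
Qed.

Lemma rcoordE i w : rcoord i w = row_mx (val (rbase w))
  (row_mx (row_mx (chart1 i.1.1 w) (chart2 i.1.2 w))
          (row_mx (chart2 i.2.1 w) (chart1 i.2.2 w))).
Proof.
have [u [v [t [t' pw]]]] := presents_exists w.
have ch := chartsE pw; case: pw => u0 [v0 [cu0 [cv0 e]]].
have -> : rcoord i w = row_mx (val (rbase w))
  (row_mx (row_mx (chart1 i.1.1 w) (chart2 i.1.2 w))
     (conj_mx (row_mx
       ((hcoord (conj_proj (wpair w).1.2) 0 i.2.1)^-1 *: hcoord (conj_proj (wpair w).1.2))
       ((hcoord (conj_proj (On_base (wpair w).1.1)) 0 i.2.2)^-1 *:
          hcoord (conj_proj (On_base (wpair w).1.1)))))) by [].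
have [_ -> _ _] := ch i.2.1; have [-> _ _ _] := ch i.2.2.
rewrite e /= On_base_pt (conj_topt _ cu0) (conj_topt _ cv0) !hcoord_normalized.
have -> (a b : 'rV[C]_2) : conj_mx (row_mx a b) = row_mx (conj_mx a) (conj_mx b).
  exact: map_row_mx.
by rewrite !conj_mxZ !conj_mxK !conj_mxE !fmorphV /= !conjCK.
Qed.

Lemma rfibE i w : rfib i w = row_mx (const_mx (fib1 i.1.1 w)) (const_mx (fib2 i.2.1 w)).
Proof.
rewrite /fib2 /rfib /=; congr (row_mx _ _); apply/rowP => k.
by rewrite !mxE.
Qed.


Lemma poly_on_rbase i f : S2reg f -> poly_on (rdom i) (rcoord i) (f \o @rbase R D).
Proof.
apply: poly_on_sphere => k.
have fE w : rcoord i w 0 (lshift (adim D) k) = val (rbase w) 0 k by exact: row_mxEl.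
exact: poly_on_ext (fun w _ => fE w) (poly_on_coord _ _ _).
Qed.

Lemma poly_on_charts i m :
  [/\ poly_on (rdom i) (rcoord i) (fun w => chart2 i.1.2 w 0 m)
    & poly_on (rdom i) (rcoord i) (fun w => chart1 i.2.2 w 0 m)].
Proof.
have cE w : rcoord i w 0 (rshift 3 (lshift (2 + 2) (rshift 2 m))) = chart2 i.1.2 w 0 m.
  by rewrite rcoordE row_mxEr row_mxEl row_mxEr.
have dE w : rcoord i w 0 (rshift 3 (rshift (2 + 2) (rshift 2 m))) = chart1 i.2.2 w 0 m.
  by rewrite rcoordE !row_mxEr.
by split; [apply: poly_on_ext (fun w _ => cE w) _|apply: poly_on_ext (fun w _ => dE w) _];
  apply: poly_on_coord.
Qed.

Lemma linpoly_on_fibs i :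
  [/\ linpoly_on (rdom i) (rcoord i) (rfib i) (fib1 i.1.1)
    & linpoly_on (rdom i) (rcoord i) (rfib i) (fib2 i.2.1)].
Proof.
have cE w : rfib i w 0 (lshift 1 0) = fib1 i.1.1 w by rewrite rfibE row_mxEl mxE.
have dE w : rfib i w 0 (rshift 1 0) = fib2 i.2.1 w by rewrite rfibE row_mxEr mxE.
by split;
  [apply: linpoly_on_ext (fun w _ => cE w) _|apply: linpoly_on_ext (fun w _ => dE w) _];
  apply: linpoly_on_coord.
Qed.

Local Notation fibre := (fibre P Q).

(** In a chart, (2 u_i v_j / T)^n (v_m / v_j)^n (t / u_i^n) = (2 / T)^n t v_m^n, and
    2 u_i v_j / T is a polynomial in x, y, z; likewise for t'. *)
Lemma fibre_chart i w : rdom i w ->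
  fibre w 0 0 =
    uv i.1.1 i.1.2 (rbase w) ^+ n * chart2 i.1.2 w 0 0 ^+ n * fib1 i.1.1 w +
    uv i.2.2 i.2.1 (rbase w) ^+ n * chart1 i.2.2 w 0 1 ^+ n * fib2 i.2.1 w /\
  fibre w 1 0 =
    height Q (rbase w) * (uv i.1.1 i.1.2 (rbase w) ^+ n * chart2 i.1.2 w 0 1 ^+ n) *
      fib1 i.1.1 w +
    - height P (rbase w) * (uv i.2.2 i.2.1 (rbase w) ^+ n * chart1 i.2.2 w 0 0 ^+ n) *
      fib2 i.2.1 w.
Proof.
have [u [v [t [t' pw]]]] := presents_exists w.
rewrite (rdomE _ pw) => /and4P[a0 b0 c0 d0].
have ov := presents_over pw; have ch := chartsE pw.
have [_ _ -> _] := ch i.1.1; have [_ -> _ _] := ch i.1.2.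
have [_ _ _ ->] := ch i.2.1; have [-> _ _ _] := ch i.2.2.
rewrite !(over_sphere_uv _ _ ov) (fibreE _ _ pw) !mxE /=.
have powE (c x y z : C) : x != 0 ->
    (c * (y * x)) ^+ n * (x^-1 * z) ^+ n = c ^+ n * y ^+ n * z ^+ n.
  by move=> x0; rewrite -!exprMn; congr (_ ^+ n); field.
have powE' (c x y z : C) : x != 0 ->
    (c * (x * y)) ^+ n * (x^-1 * z) ^+ n = c ^+ n * y ^+ n * z ^+ n.
  by move=> x0; rewrite [x * y]mulrC powE.
rewrite !powE // !powE' //.
have ui0 : u 0 i.1.1 ^+ n != 0 by rewrite expf_neq0.
have vk0 : v 0 i.2.1 ^+ n != 0 by rewrite expf_neq0.
by move: (_ ^+ n) => c; split; field; rewrite ui0 vk0.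
Qed.

Lemma linpoly_on_fibre i k : linpoly_on (rdom i) (rcoord i) (rfib i) (fun w => fibre w k 0).
Proof.
have uvn j l : poly_on (rdom i) (rcoord i) (fun w => uv j l (rbase w) ^+ n).
  exact/poly_on_exp/poly_on_rbase/S2reg_uv.
have hh p : poly_on (rdom i) (rcoord i) (fun w => height p (rbase w)).
  exact/poly_on_rbase/S2reg_height.
have [l1 l2] := linpoly_on_fibs i.
have c2 m : poly_on (rdom i) (rcoord i) (fun w => chart2 i.1.2 w 0 m ^+ n).
  by apply: poly_on_exp; have [] := poly_on_charts i m.
have c1 m : poly_on (rdom i) (rcoord i) (fun w => chart1 i.2.2 w 0 m ^+ n).
  by apply: poly_on_exp; have [] := poly_on_charts i m.
case: (I2_case k) => ->.
  apply: linpoly_on_ext (fun w Dw => esym (proj1 (fibre_chart Dw))) _.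
  apply: linpoly_on_add.
    exact: linpoly_on_mul (poly_on_mul (uvn _ _) (c2 0)) l1.
  exact: linpoly_on_mul (poly_on_mul (uvn _ _) (c1 1)) l2.
apply: linpoly_on_ext (fun w Dw => esym (proj2 (fibre_chart Dw))) _.
apply: linpoly_on_add.
  exact: linpoly_on_mul (poly_on_mul (hh Q) (poly_on_mul (uvn _ _) (c2 1))) l1.
exact: linpoly_on_mul (poly_on_mul (poly_on_opp (hh P)) (poly_on_mul (uvn _ _) (c1 0))) l2.
Qed.

Local Notation trivialise := (trivialise P Q : W -> trivial2 R).

Lemma rreg_trivialise g : sreg g -> @rreg R D (g \o trivialise).
Proof.
move=> [p Hp] i.
apply: (@poly_on_comp _ _ _ _ _ _ (fun w => row_mx (val (rbase w)) (fibre w)^T)).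
  apply: poly_on_row_coords => k.
    apply: poly_on_row; exact: poly_on_rbase (S2reg_coord R k).
  apply: linpoly_poly_on; apply: linpoly_on_ext (linpoly_on_fibre i k) => w _.
  by rewrite mxE.
by exists p => w _; apply: Hp.
Qed.

Lemma rfiblin_trivialise g : slin g -> @rfiblin R D (g \o trivialise).
Proof.
move=> [p Hp] i.
apply: (@linpoly_on_comp _ _ _ _ _ _ _ _ (fun w => val (rbase w)) _ (fun w => (fibre w)^T)).
- by move=> k; apply: poly_on_rbase (S2reg_coord R k).
- move=> k; apply: linpoly_on_ext (linpoly_on_fibre i k) => w _.
  by rewrite mxE.
by exists p => w _; apply: Hp.
Qed.

End RegularFunctions.

(** * From the charts to the trivial bundle *)

Section Gluing.
Variables (R : realType) (n : nat) (P Q : {poly R}).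
Hypothesis PQ : (1 + 'X) ^+ n * P + (1 - 'X) ^+ n * Q = 1.
Local Notation C := R[i].
Local Notation D := (descent_bundle (Ln R n) (@sigmaP1P1 R)).
Local Notation W := (rtot D).
Local Notation fibre := (fibre P Q).
Local Notation trivialise := (trivialise P Q : W -> trivial2 R).
Implicit Types (w : W) (k : 'I_2).

(** The functions on W that come from polynomials on the sphere, and those that
    correspond under [trivialise] to fibrewise linear functions and to regular functions
    on the trivial bundle. *)
Definition base_reg := poly_on xpredT (fun w => val (rbase w)).
Definition total_lin :=
  linpoly_on xpredT (fun w => val (rbase w)) (fun w => (fibre w)^T).
Definition total_reg :=
  poly_on xpredT (fun w => row_mx (val (rbase w)) (fibre w)^T).

(** The chart where u_k and v_k do not vanish.  The two charts of this kind are where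
    1 + z, respectively 1 - z, is nonzero, so they cover W. *)
Definition diag_idx k : aidx D := ((k, k), (k, k)).

Lemma rdom_diag k w : rdom (diag_idx k) w = (uv k k (rbase w) != 0).
Proof.
have [u [v [t [t' pw]]]] := presents_exists w.
have ov := presents_over pw; rewrite (rdomE _ pw) /= (over_sphere_uv _ _ ov).
rewrite !mulf_eq0 invr_eq0 (negPf (proj1 ov)) pnatr_eq0 /= !negb_or.
by case: (u 0 k != 0); case: (v 0 k != 0).
Qed.

Lemma base_reg_sphere f : S2reg f -> base_reg (f \o @rbase R D).
Proof. exact: poly_on_pullback. Qed.

(** Off the chart the denominator vanishes, so one more power of it makes each local
    identity global; a combination of the two denominators is 1 by [uv_bezout]. *)
Lemma glue (S : (W -> C) -> Prop) f :
  (forall g h, S g -> S h -> S (fun w => g w + h w)) ->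
  (forall a h, base_reg a -> S h -> S (fun w => a w * h w)) ->
  (forall k, frac (rdom (diag_idx k)) (uv k k \o @rbase R D) S f) -> S f.
Proof.
move=> Sadd Smul fr.
have global k : exists N h, S h /\ forall w, uv k k (rbase w) ^+ N * f w = h w.
  have [N [h [Sh e]]] := fr k; exists N.+1, (fun w => uv k k (rbase w) * h w).
  split; first by apply: Smul => //; apply/base_reg_sphere/S2reg_uv.
  move=> w; rewrite exprS -mulrA; have := e w; rewrite rdom_diag /=.
  by have [-> _|_ -> //] := eqVneq (uv k k (rbase w)) 0; rewrite !mul0r.
have [N0 [h0 [S0 e0]]] := global 0; have [N1 [h1 [S1 e1]]] := global 1.
have [a [b [ra rb ab]]] := uv_bezout R N0 N1.
have -> : f = (fun w => a (rbase w) * h0 w + b (rbase w) * h1 w).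
  apply/funext => w; rewrite -[LHS]mul1r -(ab (rbase w)) -e0 -e1.
  by rewrite mulrDl !mulrA.
by apply: Sadd; apply: Smul => //; apply: base_reg_sphere.
Qed.

(** u_m / u_k = (2 u_m v_k / T) / (2 u_k v_k / T). *)
Lemma frac_chart1 k m :
  frac (rdom (diag_idx k)) (uv k k \o @rbase R D) base_reg (fun w => chart1 k w 0 m).
Proof.
apply: (@frac_div _ _ _ _ _ _ (uv m k \o @rbase R D)).
  exact/base_reg_sphere/S2reg_uv.
move=> w; have [u [v [t [t' pw]]]] := presents_exists w.
have ov := presents_over pw; have [-> _ _ _] := chartsE pw k.
rewrite (rdomE _ pw) /= !(over_sphere_uv _ _ ov) mxE => /and4P[u0 _ _ _].
by field; rewrite u0 (proj1 ov).
Qed.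

Lemma frac_chart2 k m :
  frac (rdom (diag_idx k)) (uv k k \o @rbase R D) base_reg (fun w => chart2 k w 0 m).
Proof.
apply: (@frac_div _ _ _ _ _ _ (uv k m \o @rbase R D)).
  exact/base_reg_sphere/S2reg_uv.
move=> w; have [u [v [t [t' pw]]]] := presents_exists w.
have ov := presents_over pw; have [_ -> _ _] := chartsE pw k.
rewrite (rdomE _ pw) /= !(over_sphere_uv _ _ ov) mxE => /and4P[_ v0 _ _].
by field; rewrite v0 (proj1 ov).
Qed.

(** [frame_solve] divided by u_k^n and by v_k^n. *)
Lemma fibs_solve k w : rdom (diag_idx k) w ->
  fib1 k w = chart1 k w 0 0 ^+ n * height P (rbase w) * fibre w 0 0 +
             chart1 k w 0 1 ^+ n * fibre w 1 0 /\
  fib2 k w = chart2 k w 0 1 ^+ n * height Q (rbase w) * fibre w 0 0 +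
             - chart2 k w 0 0 ^+ n * fibre w 1 0.
Proof.
have [u [v [t [t' pw]]]] := presents_exists w.
have ov := presents_over pw; rewrite (rdomE _ pw) => /and4P[/= u0 v0 _ _].
have [-> -> -> ->] := chartsE pw k; have [et et'] := frame_solve PQ t t' ov.
rewrite -(fibreE _ _ pw) in et et'.
have un0 : u 0 k ^+ n != 0 by rewrite expf_neq0.
have vn0 : v 0 k ^+ n != 0 by rewrite expf_neq0.
rewrite {1}et {1}et' ![(_ *: _ : 'rV_2) _ _]mxE !exprMn !exprVn.
by split; field.
Qed.

Lemma frac_base_regX k f m :
  frac (rdom (diag_idx k)) (uv k k \o @rbase R D) base_reg f ->
  frac (rdom (diag_idx k)) (uv k k \o @rbase R D) base_reg (fun w => f w ^+ m).
Proof.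
move=> Hf; elim: m => [|m IH]; first exact/frac_incl/poly_on_cst.
apply: frac_ext (frac_mul _ Hf IH) => [w _|]; first by rewrite exprS.
exact: poly_on_mul.
Qed.

Lemma frac_fibs k :
  frac (rdom (diag_idx k)) (uv k k \o @rbase R D) total_lin (fib1 k) /\
  frac (rdom (diag_idx k)) (uv k k \o @rbase R D) total_lin (fib2 k).
Proof.
pose fr S f := frac (rdom (diag_idx k)) (uv k k \o @rbase R D) S f.
have lin j : fr total_lin (fun w => fibre w j 0).
  apply/frac_incl; apply: linpoly_on_ext (linpoly_on_coord _ _ _ j) => w _.
  by rewrite mxE.
have hh p : fr base_reg (fun w => height p (rbase w)).
  exact/frac_incl/base_reg_sphere/S2reg_height.
have add f g : fr total_lin f -> fr total_lin g -> fr total_lin (fun w => f w + g w).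
  apply: frac_add => [h|]; last exact: linpoly_on_add.
  by apply: linpoly_on_mul; apply/base_reg_sphere/S2reg_uv.
have mul a f : fr base_reg a -> fr total_lin f -> fr total_lin (fun w => a w * f w).
  by apply: frac_mul; apply: linpoly_on_mul.
have mulb a b : fr base_reg a -> fr base_reg b -> fr base_reg (fun w => a w * b w).
  by apply: frac_mul; apply: poly_on_mul.
have c1 m := frac_base_regX n (frac_chart1 k m).
have c2 m := frac_base_regX n (frac_chart2 k m).
split.
  apply: frac_ext (fun w Dw => esym (proj1 (fibs_solve Dw))) _.
  exact: add (mul _ _ (mulb _ _ (c1 0) (hh P)) (lin 0)) (mul _ _ (c1 1) (lin 1)).
apply: frac_ext (fun w Dw => esym (proj2 (fibs_solve Dw))) _.
apply: add (mul _ _ (mulb _ _ (c2 1) (hh Q)) (lin 0)) (mul _ _ _ (lin 1)).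
apply: frac_ext (mulb _ _ (frac_incl _ _ (poly_on_cst _ _ (-1))) (c2 0)) => w _.
exact: mulN1r.
Qed.

Lemma frac_rcoord k m :
  frac (rdom (diag_idx k)) (uv k k \o @rbase R D) base_reg
    (fun w => rcoord (diag_idx k) w 0 m).
Proof.
apply: frac_ext (fun w _ => esym (congr1 (fun c : 'rV_ _ => c 0 m) (rcoordE _ w))) _.
have ext f g : f =1 g -> frac (rdom (diag_idx k)) (uv k k \o @rbase R D) base_reg f ->
    frac (rdom (diag_idx k)) (uv k k \o @rbase R D) base_reg g.
  by move=> fg; apply: frac_ext => w _.
move: m; apply: (row_coord_ind ext) => m.
  exact/frac_incl/poly_on_coord.
move: m; apply: (row_coord_ind ext); apply: (row_coord_ind ext) => m.
- exact: frac_chart1.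
- exact: frac_chart2.
- exact: frac_chart2.
- exact: frac_chart1.
Qed.

Lemma frac_rfib k m :
  frac (rdom (diag_idx k)) (uv k k \o @rbase R D) total_lin
    (fun w => rfib (diag_idx k) w 0 m).
Proof.
apply: frac_ext (fun w _ => esym (congr1 (fun c : 'rV_ _ => c 0 m) (rfibE _ w))) _.
have [f1 f2] := frac_fibs k.
move: m; apply: row_coord_ind => [f g fg|m|m].
- by apply: frac_ext => w _.
- by apply: frac_ext f1 => w _; rewrite mxE.
- by apply: frac_ext f2 => w _; rewrite mxE.
Qed.

Lemma rreg_total f : @rreg R D f -> total_reg f.
Proof.
move=> rf; apply: glue.
- exact: poly_on_add.
- by move=> a h ra rh; apply: poly_on_mul rh; apply: poly_on_row ra.
move=> k; have duv : total_reg (uv k k \o @rbase R D).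
  exact/poly_on_row/base_reg_sphere/S2reg_uv.
apply: frac_poly duv _ _ _ _ (rf (diag_idx k)).
apply: row_coord_ind => [g h gh|m|m].
- by apply: frac_ext => w _.
- by apply: frac_sub (frac_rcoord k m) => h; apply: poly_on_row.
- by apply: frac_sub (frac_rfib k m) => h; apply: linpoly_poly_on.
Qed.

Lemma rfiblin_total f : @rfiblin R D f -> total_lin f.
Proof.
move=> rf; apply: glue.
- exact: linpoly_on_add.
- exact: linpoly_on_mul.
move=> k; apply: frac_linpoly (rf (diag_idx k)).
- exact/base_reg_sphere/S2reg_uv.
- exact: frac_rcoord.
- exact: frac_rfib.
Qed.

(** The trivialisation is an isomorphism of algebraic varieties. *)
Lemma rreg_trivialiseE g : @rreg R D (g \o trivialise) <-> sreg g.
Proof.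
split=> [/rreg_total[p Hp]|]; last exact: rreg_trivialise.
by exists p => e _; have [w <-] := trivialise_surj PQ e; apply: Hp.
Qed.

(** The trivialisation is an isomorphism of vector bundles. *)
Lemma rfiblin_trivialiseE g : @rfiblin R D (g \o trivialise) <-> slin g.
Proof.
split=> [/rfiblin_total[p Hp]|]; last exact: rfiblin_trivialise.
by exists p => e _; have [w <-] := trivialise_surj PQ e; apply: Hp.
Qed.

End Gluing.

(** * Points of the complexification as evaluations *)

Lemma rmorph_ext (A B : pzSemiRingType) (f g : {rmorphism A -> B}) :
  f =1 g -> f = g.
Proof.
case: f g => [f [[af] [mf]]] [g [[ag] [mg]]] /= /funext fg.
case: _ / fg in ag mg *.
by rewrite (Prop_irrelevance af ag) (Prop_irrelevance mf mg).
Qed.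

Section Points.
Variables (R : realType) (n : nat) (P Q : {poly R}).
Hypothesis PQ : (1 + 'X) ^+ n * P + (1 - 'X) ^+ n * Q = 1.
Local Notation C := R[i].
Local Notation D := (descent_bundle (Ln R n) (@sigmaP1P1 R)).
Local Notation W := (rtot D).
Local Notation trivialise := (trivialise P Q : W -> trivial2 R).
Local Notation V := (Vn R n).
Local Notation B := (qalg (Ln R n)).
Implicit Types (w : W) (f g : W -> C).

Lemma sigmaWK : involutive (@sigmaW R (Ln R n)).
Proof. by move=> w; apply: (trivialise_inj PQ); rewrite !(trivialise_sigma PQ) SigmaK. Qed.

Lemma factor_trivialise f : exists g : trivial2 R -> C, f = g \o trivialise.
Proof.
exists (fun e => f (projT1 (cid (trivialise_surj PQ e)))); apply/funext => w /=.
by case: cid => w' /= /(trivialise_inj PQ) ->.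
Qed.

(** The action of the real structure on functions; the functions fixed by it are those
    that descend to the quotient. *)
Definition twist f : W -> C := fun w => (f (sigmaW w))^*.

Lemma twist_trivialise (g : trivial2 R -> C) :
  twist (g \o trivialise) = (fun e => (g (Sigma n P Q e))^*) \o trivialise.
Proof. by apply/funext => w; rewrite /twist /= (trivialise_sigma PQ). Qed.

(** The trivialisation carries the descent involution to Sigma_n, which is antiregular. *)
Lemma rreg_twist f : @rreg R D f -> @rreg R D (twist f).
Proof.
have [g ->] := factor_trivialise f; rewrite twist_trivialise.
move=> /(rreg_trivialiseE PQ) rg.
exact/(rreg_trivialiseE PQ)/sreg_Sigma.
Qed.

Lemma rfiblin_twist f : @rfiblin R D f -> @rfiblin R D (twist f).
Proof.
have [g ->] := factor_trivialise f; rewrite twist_trivialise.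
move=> /(rfiblin_trivialiseE PQ) rg.
exact/(rfiblin_trivialiseE PQ)/slin_Sigma.
Qed.

Definition re_part f w : C := 2^-1 * f w + 2^-1 * twist f w.
Definition im_part f w : C := - ('i / 2) * f w + 'i / 2 * twist f w.

Lemma re_im_part f w : f w = re_part f w + 'i * im_part f w.
Proof.
have sqi : 'i * 'i = -1 :> C by rewrite -expr2 sqrCi.
by rewrite /re_part /im_part; field: sqi.
Qed.

Lemma re_im_invariant f w : re_part f (sigmaW w) = (re_part f w)^* /\
  im_part f (sigmaW w) = (im_part f w)^*.
Proof.
rewrite /re_part /im_part /twist sigmaWK.
rewrite !(fmorphV, rmorph_nat, rmorphM, rmorphN, rmorphD) /= !conjCK conjCi.
by split; ring.
Qed.

Lemma rreg_re_im f : @rreg R D f -> @rreg R D (re_part f) /\ @rreg R D (im_part f).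
Proof.
move=> rf; have rt := rreg_twist rf.
have scal (a : C) g : @rreg R D g -> @rreg R D (fun w => a * g w).
  by move=> rg i; apply: poly_on_mul (poly_on_cst _ _ a) (rg i).
by split=> i; apply: poly_on_add; move: i; apply: scal.
Qed.

Lemma rfiblin_re_im f :
  @rfiblin R D f -> @rfiblin R D (re_part f) /\ @rfiblin R D (im_part f).
Proof.
move=> rf; have rt := rfiblin_twist rf.
have scal (a : C) g : @rfiblin R D g -> @rfiblin R D (fun w => a * g w).
  by move=> rg i; apply: linpoly_on_mul (poly_on_cst _ _ a) (rg i).
by split=> i; apply: linpoly_on_add; move: i; apply: scal.
Qed.

(** Galois descent for functions: the regular functions on W are the complexification of
    the invariant ones. *)
Lemma rreg_split f : @rreg R D f -> exists b c : B,
  [/\ val b = re_part f, val c = im_part f & forall w, f w = val b w + 'i * val c w].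
Proof.
move=> /rreg_re_im[rb rc].
have hb : re_part f \in @descended R (Ln R n).
  by apply/asboolP; split=> // w; have [] := re_im_invariant f w.
have hc : im_part f \in @descended R (Ln R n).
  by apply/asboolP; split=> // w; have [] := re_im_invariant f w.
pose b : B := exist _ (re_part f) hb; pose c : B := exist _ (im_part f) hc.
by exists b, c; split => // w; apply: re_im_part.
Qed.

Lemma qalg_reg (b : B) : @rreg R D (val b) /\ forall w, val b (sigmaW w) = (val b w)^*.
Proof. by have /asboolP := valP b. Qed.

Lemma qalg_valE (b c : B) w :
  [/\ val (b + c) w = val b w + val c w, val (b - c) w = val b w - val c w
    & val (b * c) w = val b w * val c w].
Proof. by []. Qed.

(** Conjugation changes b + i c at sigma w into b - i c at w, so both are known. *)
Lemma split_inj (b c b' c' : B) :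
  (forall w, val b w + 'i * val c w = val b' w + 'i * val c' w) -> b = b' /\ c = c'.
Proof.
move=> e; have two0 : (2 : C) != 0 by rewrite pnatr_eq0.
have e' w : val b w - 'i * val c w = val b' w - 'i * val c' w.
  have := congr1 Num.conj (e (sigmaW w)).
  rewrite !(proj2 (qalg_reg _)) !(rmorphD, rmorphM) /= !conjCK conjCi.
  by rewrite !mulNr.
split; apply/val_inj/funext => w; apply: (mulfI two0).
  transitivity ((val b w + 'i * val c w) + (val b w - 'i * val c w)); first by ring.
  by rewrite e e'; ring.
apply: (mulfI (neq0Ci C)).
transitivity ((val b w + 'i * val c w) - (val b w - 'i * val c w)); first by ring.
by rewrite e e'; ring.
Qed.

Definition eval_at w (b : balg V) : C := val (b : B) w.

Lemma eval_at_zmod w : zmod_morphism (eval_at w).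
Proof. by []. Qed.

Lemma eval_at_monoid w : monoid_morphism (eval_at w).
Proof. by []. Qed.

HB.instance Definition _ w :=
  GRing.isZmodMorphism.Build (balg V) C (eval_at w) (eval_at_zmod w).
HB.instance Definition _ w :=
  GRing.isMonoidMorphism.Build (balg V) C (eval_at w) (eval_at_monoid w).

Lemma eval_at_scal w (a : R) : eval_at w (bscal V a) = a%:C%C.
Proof. by []. Qed.

Definition eval_pt w : cpoint V := CPoint (eval_at_scal w).

Lemma cpoint_ext (phi psi : cpoint V) : (forall b, phi b = psi b) -> phi = psi.
Proof.
case: phi => [f hf]; case: psi => [g hg] /= /rmorph_ext fg.
by case: _ / fg in hg *; rewrite (Prop_irrelevance hf hg).
Qed.

(** The regular functions on W are polynomials in five coordinates, so the
    complex-linear extension of phi is determined by its values on them, and these are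
    the coordinates of a point of the sphere and of a vector. *)
Lemma cpoint_eval (phi : cpoint V) : exists w, phi = eval_pt w.
Proof.
pose value f (z : C) := exists b c : B,
  (forall w, f w = val b w + 'i * val c w) /\ z = phi b + 'i * phi c.
have value_add f g y z : value f y -> value g z -> value (fun w => f w + g w) (y + z).
  move=> [b [c [ef ->]]] [b' [c' [eg ->]]]; exists (b + b'), (c + c'); split.
    move=> w; rewrite ef eg.
    by have [-> _ _] := qalg_valE b b' w; have [-> _ _] := qalg_valE c c' w; ring.
  by rewrite !rmorphD; ring.
have sqi : 'i * 'i = -1 :> C by rewrite -expr2 sqrCi.
have value_mul f g y z : value f y -> value g z -> value (fun w => f w * g w) (y * z).
  move=> [b [c [ef ->]]] [b' [c' [eg ->]]].
  exists (b * b' - c * c'), (b * c' + c * b'); split.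
    move=> w; rewrite ef eg.
    have [_ -> _] := qalg_valE (b * b') (c * c') w.
    have [-> _ _] := qalg_valE (b * c') (c * b') w.
    have [_ _ ->] := qalg_valE b b' w; have [_ _ ->] := qalg_valE c c' w.
    have [_ _ ->] := qalg_valE b c' w; have [_ _ ->] := qalg_valE c b' w.
    by ring: sqi.
  by rewrite !(rmorphB, rmorphD, rmorphM); ring: sqi.
have value_cst (a : C) : value (fun=> a) a.
  exists (bscal V (complex.Re a)), (bscal V (complex.Im a)).
  by rewrite !ceval_scal /= -complexiE; split=> [w|]; apply: complexE.
have value_rreg f : @rreg R D f -> exists z, value f z.
  by move=> /rreg_split[b [c [_ _ e]]]; exists (phi b + 'i * phi c), b, c.
have lin k : @rreg R D ((fun e : trivial2 R => e.2 k 0) \o trivialise).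
  apply/(rreg_trivialiseE PQ)/linpoly_poly_on.
  by apply: linpoly_on_ext (linpoly_on_coord _ _ _ k) => e _; rewrite mxE.
(* phi extends to a C-algebra homomorphism on all regular functions; the point
   wanted is the one whose coordinates are its values on the coordinates. *)
have [z0 v0] := value_rreg _ (lin 0); have [z1 v1] := value_rreg _ (lin 1).
have [w ew] := trivialise_surj PQ
  ((cproj phi, \col_k (if k == 0 then z0 else z1)) : trivial2 R).
exists w; apply: cpoint_ext => b.
have coord_value k : value (fun x => row_mx (val (rbase x)) (fibre P Q x)^T 0 k)
    (row_mx (val (rbase w)) (fibre P Q w)^T 0 k).
  have ext f f' z z' : f =1 f' -> z = z' -> value f z -> value f' z'.
    by move=> /funext -> ->.
  case: (split_ordP k) => j ->.
    apply: (ext (fun x : W => val (rbase x) 0 j) _ (phi (bbase V j))).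
    - by move=> x; rewrite row_mxEl.
    - by rewrite row_mxEl -[rbase w]/(trivialise w).1 ew /= mxE.
    exists (bbase V j), 0; split => [x|]; last by rewrite rmorph0 mulr0 addr0.
    by rewrite /= mulr0 addr0.
  case: (I2_case j) => ->.
    apply: ext v0 => [x|]; first by rewrite row_mxEr mxE.
    by rewrite row_mxEr mxE -[fibre _ _ w]/(trivialise w).2 ew /= mxE.
  apply: ext v1 => [x|]; first by rewrite row_mxEr mxE.
  by rewrite row_mxEr mxE -[fibre _ _ w]/(trivialise w).2 ew /= mxE.
have [b' [c' [e e']]] : value (val b) (val b w).
  have := rreg_total PQ (proj1 (qalg_reg b)).
  apply: (poly_on_ind (S := fun f => value f (f w))) => //.
  - by move=> f g fg; have -> : f = g by apply/funext => x; apply: fg.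
  - by move=> f g; apply: value_add.
  - by move=> f g; apply: value_mul.
have [eb ec] : b' = b /\ c' = 0.
  by apply: split_inj => x; rewrite -e /= mulr0 addr0.
by rewrite [RHS]e' eb ec rmorph0 mulr0 addr0.
Qed.

Lemma rreg_coord (k : 'I_(3 + 2)) :
  @rreg R D ((fun e : trivial2 R => row_mx (val e.1) e.2^T 0 k) \o trivialise).
Proof. exact/(rreg_trivialiseE PQ)/poly_on_coord. Qed.

(** The coordinates separate the points of W, and they are combinations of invariant
    functions. *)
Lemma eval_pt_inj : injective eval_pt.
Proof.
move=> w w' e; apply: (trivialise_inj PQ).
have same k : row_mx (val (trivialise w).1) (trivialise w).2^T 0 k =
              row_mx (val (trivialise w').1) (trivialise w').2^T 0 k.
  have [b [c [_ _ ebc]]] := rreg_split (rreg_coord k).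
  have val_eq (a : B) : val a w = val a w' := congr1 (fun phi : cpoint V => phi a) e.
  by have := ebc w'; rewrite -!val_eq -ebc.
have [e1 e2] : val (trivialise w).1 = val (trivialise w').1 /\
    (trivialise w).2^T = (trivialise w').2^T.
  by apply: eq_row_mx; apply/rowP.
by apply: injective_projections; [apply: val_inj|apply: trmx_inj].
Qed.

Definition Theta (phi : complexification V) : trivial2 R :=
  trivialise (projT1 (cid (cpoint_eval phi))).

Lemma Theta_eval w : Theta (eval_pt w) = trivialise w.
Proof. by rewrite /Theta; case: cid => w' /= /eval_pt_inj ->. Qed.

Lemma eval_pt_sigma w :
  canonical_real_structure (eval_pt w : complexification V) = eval_pt (sigmaW w).
Proof. by apply: cpoint_ext => b; symmetry; apply: (proj2 (qalg_reg b)). Qed.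

Lemma Theta_sigma (phi : complexification V) :
  Sigma n P Q (Theta phi) = Theta (canonical_real_structure phi).
Proof.
by have [w ->] := cpoint_eval phi; rewrite eval_pt_sigma !Theta_eval (trivialise_sigma PQ).
Qed.

Lemma Theta_bij : bijective Theta.
Proof.
exists (fun e => eval_pt (projT1 (cid (trivialise_surj PQ e)))) => [phi|e].
  have [w ->] := cpoint_eval phi; rewrite Theta_eval.
  by case: cid => w' /= /(trivialise_inj PQ) ->.
by rewrite Theta_eval; case: cid.
Qed.

Lemma Theta_proj (phi : complexification V) : sproj (Theta phi) = sproj phi.
Proof.
have [w ->] := cpoint_eval phi; rewrite Theta_eval; apply: val_inj.
by apply/rowP => k; rewrite mxE.
Qed.

Lemma sreg_Theta (g : trivial2 R -> C) : sreg g <-> sreg (g \o Theta).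
Proof.
split=> [/(rreg_trivialiseE PQ) rg|[b [c e]]].
  have [b [c [_ _ ebc]]] := rreg_split rg; exists b, c => phi.
  by have [w ->] := cpoint_eval phi; rewrite -[RHS](ebc w) /= Theta_eval.
apply/(rreg_trivialiseE PQ).
have -> : g \o trivialise = fun w => val (b : B) w + 'i * val (c : B) w.
  by apply/funext => w; have := e (eval_pt w); rewrite /= Theta_eval.
move=> i; apply: poly_on_add; first exact: (proj1 (qalg_reg b)).
apply: poly_on_mul; [exact: poly_on_cst|exact: (proj1 (qalg_reg c))].
Qed.

Lemma slin_Theta (g : trivial2 R -> C) : slin g <-> slin (g \o Theta).
Proof.
split=> [lg|[b [c [lb lc e]]]].
  have [b [c [eb ec ebc]]] := rreg_split (rreg_trivialise P Q (linpoly_poly_on lg)).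
  have [lb lc] := rfiblin_re_im (rfiblin_trivialise P Q lg).
  exists b, c; split; rewrite /= ?eb ?ec //.
  by move=> phi; have [w ->] := cpoint_eval phi; rewrite -[RHS](ebc w) /= Theta_eval.
apply/(rfiblin_trivialiseE PQ).
have -> : g \o trivialise = fun w => val (b : B) w + 'i * val (c : B) w.
  by apply/funext => w; have := e (eval_pt w); rewrite /= Theta_eval.
move=> i; apply: linpoly_on_add; first exact: lb.
apply: linpoly_on_mul; [exact: poly_on_cst|exact: lc].
Qed.

End Points.

Theorem proposition13 (R : realType) (n : nat) (n_ge1 : (1 <= n)%N)
    (P Q : {poly R})
    (PQ : (1 + 'X) ^+ n * P + (1 - 'X) ^+ n * Q = 1) :
  (S2_GL2 (An n P Q) /\ real_structure (Sigma n P Q)) /\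
  (exists Theta : complexification (Vn R n) -> trivial2 R,
     bundle_iso Theta /\
     forall phi : complexification (Vn R n),
       Sigma n P Q (Theta phi) = Theta (canonical_real_structure phi)).
Proof.
split; first by split; [exact: An_GL2 | split; [exact: SigmaK | exact: sreg_Sigma]].
exists (Theta PQ); split; last exact: Theta_sigma.
split; [exact: Theta_bij|exact: Theta_proj|exact: sreg_Theta|exact: slin_Theta].
Qed.
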